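(* Let $D_M$ be an integrable Dirac structure on a smooth manifold $M$ and let $B$ be a closed 2-form on $M$. Then the categories $\mathcal{H}(M,D_M)$ and $\mathcal{H}(M,\tau_B(D_M))$ are equivalent.
   Context: $\Gamma^\infty(E)$ denotes the smooth sections of a vector bundle $E$, and $\mathfrak{X}(N)=\Gamma^\infty(TN)$. Dirac structures. On $TM\oplus T^*M$ consider the pairing $\langle(U,\alpha),(V,\beta)\rangle=\beta(U)+\alpha(V)$ and the bracket $[[(U,\alpha),(V,\beta)]]=([U,V],\mathcal{L}_U\beta-\mathrm{i}_Vd\alpha)$ on sections. A Dirac structure on $M$ is a subbundle $D_M\subset TM\oplus T^*M$ of rank $\dim M$ on which the pairing vanishes and such that $\Gamma^\infty(D_M)$ is closed under the bracket; $(M,D_M)$ is called a Dirac manifold. $D_M$ is a Lie algebroid over $M$ with the restricted bracket and with anchor the projection to $TM$. $D_M$ is integrable if there is a Lie groupoid over $M$ whose Lie algebroid is isomorphic to $D_M$. The gauge transformation of $D_M$ by a closed 2-form $B$ is the Dirac structure $\tau_B(D_M)=\{(Y,\beta+\mathrm{i}_YB) : (Y,\beta)\in D_M\}$. Dirac maps. A smooth map $F:(N,D_N)\to(M,D_M)$ between Dirac manifolds is a forward Dirac map if for every $n\in N$, $(D_M)_{F(n)}=\{((dF)_nU,\beta)\in T_{F(n)}M\oplus T^*_{F(n)}M : U\in T_nN,\ (U,(dF)_n^*\beta)\in(D_N)_n\}$. It is a strong Dirac map if moreover $\ker(dF)_n\cap\ker(D_N)_n=\{0\}$ for all $n\in N$,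 where $\ker(D_N)_n=(D_N)_n\cap T_nN$. A strong Dirac map $F$ induces a map $\zeta:\Gamma^\infty(D_M)\to\mathfrak{X}(N)$, $(V,\beta)\mapsto\hat V$, where $\hat V_n$ is the unique tangent vector with $(dF)_n\hat V_n=V_{F(n)}$ and $(\hat V_n,(dF)_n^*\beta)\in(D_N)_n$; this is an infinitesimal action of the Lie algebroid $D_M$ on $F:N\to M$. $F$ is complete if $\zeta(\sigma)$ is a complete vector field whenever $\sigma\in\Gamma^\infty(D_M)$ has compact support. The category $\mathcal{H}(M,D_M)$ (a subcategory of the Hamiltonian category of $(M,D_M)$). Its objects are complete strong Dirac maps $F:N\to M$ (from Dirac manifolds $(N,D_N)$ to $(M,D_M)$) that are surjective submersions, and its morphisms from $F:N\to M$ to $F':N'\to M$ are forward Dirac maps $\varphi:N\to N'$ such that $F=F'\circ\varphi$. *)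

(* Defs.v *)
From HB Require Import structures.
From mathcomp Require Import all_boot all_order all_algebra.
From mathcomp Require Import all_classical all_reals all_analysis.
From mathcomp Require Import ring.
Import Order.TTheory GRing.Theory Num.Theory.
Import numFieldNormedType.Exports.

Set Implicit Arguments.
Unset Strict Implicit.
Unset Printing Implicit Defensive.

Local Open Scope classical_set_scope.
Local Open Scope ring_scope.

(* Used only with V, W finite dimensional and U open, where asking every
   directional derivative to be C^k is the same as asking it of the partial
   derivatives, or of the Frechet derivative. *)
Fixpoint Ck (R : realType) (V W : normedModType R) (k : nat) (U : set V)
    (f : V -> W) : Prop :=
  match k with
  | 0%N => forall x, U x -> {for x, continuous f}
  | k'.+1 => (forall x, U x -> differentiable f x) /\
             (forall v, Ck k' U (fun x => 'D_v f x))
  end.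

Definition smooth_on (R : realType) (V W : normedModType R) (U : set V)
    (f : V -> W) : Prop := forall k, Ck k U f.

(* [cinv] is only meaningful on the image of [cdom] under [cmap]. *)
Record chart (R : realType) (T : topologicalType) (n : nat) := Chart {
  cdom : set T;
  cmap : T -> 'rV[R]_n;
  cinv : 'rV[R]_n -> T;
  cdom_open : open cdom;
  cimg_open : open (cmap @` cdom);
  cmapK : forall x, cdom x -> cinv (cmap x) = x;
  cmap_continuous : {within cdom, continuous cmap};
  cinv_continuous : {within cmap @` cdom, continuous cinv} }.

(* No separation or countability axiom: the arrows of a Lie groupoid may form a
   non-Hausdorff manifold. *)
Record preManifold (R : realType) := PreManifold {
  pm_space :> topologicalType;
  dimM : nat;
  atlas : set (chart R pm_space dimM);
  atlas_cover : forall x, exists2 c, atlas c & cdom c x;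
  atlas_compatible : forall c d, atlas c -> atlas d ->
    smooth_on (cmap c @` (cdom c `&` cdom d)) (cmap d \o cinv c) }.

Record manifold (R : realType) := Manifold {
  mf_pre :> preManifold R;
  mf_hausdorff : hausdorff_space mf_pre;
  mf_second_countable : @second_countable mf_pre }.

Definition smooth_at (R : realType) (M : preManifold R) (p : M) (f : M -> R) :
    Prop :=
  forall c, atlas c -> cdom c p ->
    exists W : set 'rV[R]_(dimM M),
      [/\ open W, W (cmap c p) & smooth_on W (f \o cinv c)].

(* Testing on germs of functions includes testing on the coordinate functions
   of a chart, so for a continuous map this is smoothness in charts. *)
Definition smooth_map (R : realType) (N M : preManifold R) (F : N -> M) : Prop :=
  continuous F /\
  forall n g, smooth_at (F n) g -> smooth_at n (g \o F).

(* Raw types; the tangent and cotangent spaces at a point are the subspaces cut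
   out by [tangent] and [cotangent] below.  Vectors are normalised to vanish on
   irrelevant arguments, so that Leibniz equality is equality of vectors. *)
Definition tvec (R : realType) (M : preManifold R) : lmodType R :=
  ((M -> R) -> R : lmodType R).
Definition covec (R : realType) (M : preManifold R) : lmodType R :=
  (tvec M -> R : lmodType R).
Definition gtvec (R : realType) (M : preManifold R) : lmodType R :=
  ((tvec M * covec M)%type : lmodType R).

(* Derivations of germs at [p].  That [v f] depends only on the germ of [f]
   follows from the Leibniz rule applied to [f] and the indicator function of a
   neighbourhood of [p], which is in the domain of [v]. *)
Definition tangent (R : realType) (M : preManifold R) (p : M) (v : tvec M) :
    Prop :=
  [/\ forall f, ~ smooth_at p f -> v f = 0,
      forall (a : R) f g, smooth_at p f -> smooth_at p g ->
        v (fun x => a * f x + g x) = a * v f + v g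
    & forall f g, smooth_at p f -> smooth_at p g ->
        v (fun x => f x * g x) = v f * g p + f p * v g].

Definition cotangent (R : realType) (M : preManifold R) (p : M) (b : covec M) :
    Prop :=
  (forall v, ~ tangent p v -> b v = 0) /\
  (forall (a : R) v w, tangent p v -> tangent p w ->
     b (a *: v + w) = a * b v + b w).

(* The guard is needed because g \o F may be smooth at n without g being smooth
   at F n. *)
Definition dmap (R : realType) (N M : preManifold R) (F : N -> M) (n : N)
    (v : tvec N) : tvec M :=
  fun g => if `[< smooth_at (F n) g >] then v (g \o F) else 0.

Definition comap (R : realType) (N M : preManifold R) (F : N -> M) (n : N)
    (b : covec M) : covec N :=
  fun v => if `[< tangent n v >] then b (dmap F n v) else 0.

Definition vfield_on (R : realType) (M : preManifold R) (U : set M)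
    (X : M -> tvec M) : Prop :=
  forall x, U x -> tangent x (X x) /\
    forall f, smooth_at x f -> smooth_at x (fun y => X y f).

Definition lie (R : realType) (M : preManifold R) (X Y : M -> tvec M) :
    M -> tvec M :=
  fun p f => if `[< smooth_at p f >] then
    X p (fun y => Y y f) - Y p (fun y => X y f) else 0.

Definition one_form_on (R : realType) (M : preManifold R) (U : set M)
    (a : M -> covec M) : Prop :=
  (forall x, U x -> cotangent x (a x)) /\
  (forall (V : set M) X, open V -> vfield_on V X ->
     forall x, U x -> V x -> smooth_at x (fun y => a y (X y))).

Definition two_form (R : realType) (M : preManifold R)
    (B : M -> tvec M -> covec M) : Prop :=
  [/\ forall x v, cotangent x (B x v),
      forall x w, cotangent x ((fun v => B x v w) : covec M),
      forall x v, B x v v = 0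
    & forall (V : set M) X Y, open V -> vfield_on V X -> vfield_on V Y ->
        forall x, V x -> smooth_at x (fun y => B y (X y) (Y y))].

(* (L_X b)(Z) *)
Definition lie_deriv1 (R : realType) (M : preManifold R) (X : M -> tvec M)
    (b : M -> covec M) (Z : M -> tvec M) (p : M) : R :=
  X p (fun q => b q (Z q)) - b p (lie X Z p).

(* (d a)(Y, Z) *)
Definition ext_deriv1 (R : realType) (M : preManifold R) (a : M -> covec M)
    (Y Z : M -> tvec M) (p : M) : R :=
  Y p (fun q => a q (Z q)) - Z p (fun q => a q (Y q)) - a p (lie Y Z p).

(* (d B)(X, Y, Z) *)
Definition ext_deriv2 (R : realType) (M : preManifold R)
    (B : M -> tvec M -> covec M) (X Y Z : M -> tvec M) (p : M) : R :=
  X p (fun q => B q (Y q) (Z q)) - Y p (fun q => B q (X q) (Z q))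
  + Z p (fun q => B q (X q) (Y q))
  - B p (lie X Y p) (Z p) + B p (lie X Z p) (Y p) - B p (lie Y Z p) (X p).

Definition closed_two_form (R : realType) (M : preManifold R)
    (B : M -> tvec M -> covec M) : Prop :=
  two_form B /\
  forall (V : set M) X Y Z, open V ->
    vfield_on V X -> vfield_on V Y -> vfield_on V Z ->
    forall p, V p -> ext_deriv2 B X Y Z p = 0.

Definition gsection_on (R : realType) (M : preManifold R) (U : set M)
    (s : M -> gtvec M) : Prop :=
  vfield_on U (fun x => (s x).1) /\ one_form_on U (fun x => (s x).2).

Definition section_of (R : realType) (M : preManifold R)
    (D : M -> set (gtvec M)) (s : M -> gtvec M) : Prop :=
  gsection_on setT s /\ forall x, D x (s x).

(* r = [[s, t]].  The 1-form L_U b - i_V (d a) is specified by its values on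
   vector fields Z defined on open sets; every tangent vector extends to such a
   field, so this determines it. *)
Definition is_bracket (R : realType) (M : preManifold R)
    (s t r : M -> gtvec M) : Prop :=
  let U := fun x => (s x).1 in let a := fun x => (s x).2 in
  let V := fun x => (t x).1 in let b := fun x => (t x).2 in
  (forall p, (r p).1 = lie U V p) /\
  (forall (O : set M) Z, open O -> vfield_on O Z -> forall p, O p ->
     (r p).2 (Z p) = lie_deriv1 U b Z p - ext_deriv1 a V Z p).

Definition frame_on (R : realType) (M : preManifold R) (n : nat) (U : set M)
    (D : M -> set (gtvec M)) (e : 'I_n -> M -> gtvec M) : Prop :=
  [/\ forall i, gsection_on U (e i),
      forall x, U x ->
        D x = [set s | exists c : 'I_n -> R, s = \sum_i c i *: e i x]
    & forall x, U x -> forall c : 'I_n -> R,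
        \sum_i c i *: e i x = 0 -> forall i, c i = 0].

Record diracStructure (R : realType) (M : preManifold R) := Dirac {
  dfib :> M -> set (gtvec M);
  dirac_sub : forall x s, dfib x s -> tangent x s.1 /\ cotangent x s.2;
  dirac_isotropic : forall x s t, dfib x s -> dfib x t ->
    t.2 s.1 + s.2 t.1 = 0;
  dirac_subbundle : forall x, exists U : set M,
    [/\ open U, U x & exists e : 'I_(dimM M) -> M -> gtvec M,
        frame_on U dfib e];
  dirac_involutive : forall s t, section_of dfib s -> section_of dfib t ->
    exists2 r, section_of dfib r & is_bracket s t r }.

Definition gauge_fib (R : realType) (M : preManifold R)
    (D : M -> set (gtvec M)) (B : M -> tvec M -> covec M) (x : M) :
    set (gtvec M) :=
  [set (s.1, s.2 + B x s.1) | s in D x].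

Definition forward_dirac (R : realType) (N M : preManifold R)
    (DN : diracStructure N) (DM : diracStructure M) (F : N -> M) : Prop :=
  smooth_map F /\
  forall n, DM (F n) = [set s | exists U b,
    [/\ s = (dmap F n U, b), tangent n U, cotangent (F n) b
      & DN n (U, comap F n b)]].

Definition strong_dirac (R : realType) (N M : preManifold R)
    (DN : diracStructure N) (DM : diracStructure M) (F : N -> M) : Prop :=
  forward_dirac DN DM F /\
  forall n U, dmap F n U = 0 -> DN n (U, 0) -> U = 0.

(* For a strong Dirac map and a section s of the Dirac structure of M, the set
   below is a singleton; [xget] picks its element. *)
Definition zeta (R : realType) (N M : preManifold R) (DN : diracStructure N)
    (F : N -> M) (s : M -> gtvec M) (n : N) : tvec N :=
  xget 0 [set v | [/\ tangent n v, dmap F n v = (s (F n)).1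
                    & DN n (v, comap F n (s (F n)).2)]].

Definition integral_curve (R : realType) (N : preManifold R)
    (X : N -> tvec N) (g : R -> N) : Prop :=
  continuous g /\
  forall t f, smooth_at (g t) f -> is_derive t (1 : R) (f \o g) (X (g t) f).

Definition complete_vfield (R : realType) (N : preManifold R)
    (X : N -> tvec N) : Prop :=
  forall p, exists2 g : R -> N, g 0 = p & integral_curve X g.

Definition complete_dirac (R : realType) (N M : preManifold R)
    (DN : diracStructure N) (DM : diracStructure M) (F : N -> M) : Prop :=
  forall s, section_of DM s -> compact (closure [set m | s m <> 0]) ->
    complete_vfield (zeta DN F s).

Definition submersion (R : realType) (N M : preManifold R) (F : N -> M) : Prop :=
  smooth_map F /\
  forall n w, tangent (F n) w -> exists2 v, tangent n v & dmap F n v = w.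

(* [gmul g h] is meaningful when [gsrc g = gtgt h].  [mul_smooth] is smoothness on
   the embedded submanifold of composable pairs: in charts, [gmul] locally
   extends to a smooth function. *)
Record lieGroupoid (R : realType) (M : manifold R) := LieGroupoid {
  garr :> preManifold R;
  arr_second_countable : @second_countable garr;
  gsrc : garr -> M;
  gtgt : garr -> M;
  gunit : M -> garr;
  ginv : garr -> garr;
  gmul : garr -> garr -> garr;
  src_mul : forall g h, gsrc g = gtgt h -> gsrc (gmul g h) = gsrc h;
  tgt_mul : forall g h, gsrc g = gtgt h -> gtgt (gmul g h) = gtgt g;
  mul_assoc : forall g h k, gsrc g = gtgt h -> gsrc h = gtgt k ->
    gmul g (gmul h k) = gmul (gmul g h) k;
  src_unt : forall x, gsrc (gunit x) = x;
  tgt_unt : forall x, gtgt (gunit x) = x;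
  mul_unt_l : forall g, gmul (gunit (gtgt g)) g = g;
  mul_unt_r : forall g, gmul g (gunit (gsrc g)) = g;
  src_inv : forall g, gsrc (ginv g) = gtgt g;
  tgt_inv : forall g, gtgt (ginv g) = gsrc g;
  mul_inv_l : forall g, gmul (ginv g) g = gunit (gsrc g);
  mul_inv_r : forall g, gmul g (ginv g) = gunit (gtgt g);
  src_submersion : submersion gsrc;
  tgt_submersion : submersion gtgt;
  unt_smooth : smooth_map gunit;
  inv_smooth : smooth_map ginv;
  mul_continuous : {within [set gh : garr * garr | gsrc gh.1 = gtgt gh.2],
    continuous (fun gh => gmul gh.1 gh.2)};
  mul_smooth : forall g h, gsrc g = gtgt h ->
    forall f, smooth_at (gmul g h) f ->
    forall c d, atlas c -> atlas d -> cdom c g -> cdom d h ->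
    exists (W : set ('rV[R]_(dimM garr) * 'rV[R]_(dimM garr)))
           (q : 'rV[R]_(dimM garr) * 'rV[R]_(dimM garr) -> R),
      [/\ open W, W (cmap c g, cmap d h), smooth_on W q
        & forall x y, W (x, y) -> gsrc (cinv c x) = gtgt (cinv d y) ->
            f (gmul (cinv c x) (cinv d y)) = q (x, y)] }.

Definition algd_fib (R : realType) (M : manifold R) (G : lieGroupoid M)
    (x : M) : set (tvec G) :=
  [set v | tangent (gunit G x) v /\ dmap (@gsrc R M G) (gunit G x) v = 0].

(* X is tangent to the source fibres, and X (h g) is the image of X h under the
   differential of right translation by g.  The latter is only defined on the
   source fibre through h, hence the extension F of the translated function. *)
Definition right_invariant (R : realType) (M : manifold R)
    (G : lieGroupoid M) (X : G -> tvec G) : Prop :=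
  [/\ vfield_on setT X,
      forall g, dmap (@gsrc R M G) g (X g) = 0
    & forall h g : G, gsrc h = gtgt g ->
        forall f F, smooth_at (gmul h g) f -> smooth_at h F ->
          (\forall k \near h, gsrc k = gtgt g -> F k = f (gmul k g)) ->
          X (gmul h g) f = X h F].

(* Phi is an isomorphism onto D of the Lie algebroid of G, the vector bundle
   with fibres [algd_fib G x], anchor the differential of the target, and
   sections identified with right-invariant vector fields on G. *)
Definition algd_iso (R : realType) (M : manifold R) (D : diracStructure M)
    (G : lieGroupoid M) (Phi : M -> tvec G -> gtvec M) : Prop :=
  let sec (X : G -> tvec G) := fun x : M => Phi x (X (gunit G x)) in
  [/\ forall x (a : R) v w, algd_fib x v -> algd_fib x w ->
        Phi x (a *: v + w) = a *: Phi x v + Phi x w,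
      forall x, set_bij (algd_fib x) (D x) (Phi x),
      forall X, right_invariant X -> section_of D (sec X),
      forall x v, algd_fib x v ->
        (Phi x v).1 = dmap (@gtgt R M G) (gunit G x) v
    & forall X Y, right_invariant X -> right_invariant Y ->
        is_bracket (sec X) (sec Y) (sec (lie X Y))].

Definition integrable_dirac (R : realType) (M : manifold R) (D : diracStructure M) :
    Prop :=
  exists (G : lieGroupoid M) (Phi : M -> tvec G -> gtvec M), algd_iso D Phi.

Record category := Category {
  obj :> Type;
  hom : obj -> obj -> Type;
  idm : forall a, hom a a;
  compm : forall a b c, hom b c -> hom a b -> hom a c;
  comp_idl : forall a b (f : hom a b), compm (idm b) f = f;
  comp_idr : forall a b (f : hom a b), compm f (idm a) = f;
  comp_assoc : forall a b c d (h : hom c d) (g : hom b c) (f : hom a b),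
    compm h (compm g f) = compm (compm h g) f }.

Record cfunctor (C D : category) := CFunctor {
  fobj :> C -> D;
  fhom : forall a b, hom a b -> hom (fobj a) (fobj b);
  fhom_id : forall a, fhom (idm a) = idm (fobj a);
  fhom_comp : forall a b c (g : hom b c) (f : hom a b),
    fhom (compm g f) = compm (fhom g) (fhom f) }.

Definition functor_id (C : category) : cfunctor C C :=
  @CFunctor C C id (fun a b f => f) (fun a => erefl) (fun a b c g f => erefl).

Lemma functor_comp_id (C D E : category) (G : cfunctor D E) (F : cfunctor C D)
  (a : C) : fhom G (fhom F (idm a)) = idm (G (F a)).
Proof. by rewrite !fhom_id. Qed.

Lemma functor_comp_comp (C D E : category) (G : cfunctor D E)
  (F : cfunctor C D) (a b c : C) (g : hom b c) (f : hom a b) :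
  fhom G (fhom F (compm g f)) =
  compm (fhom G (fhom F g)) (fhom G (fhom F f)).
Proof. by rewrite !fhom_comp. Qed.

Definition functor_comp (C D E : category) (G : cfunctor D E)
    (F : cfunctor C D) : cfunctor C E :=
  @CFunctor C E (fun a => G (F a)) (fun a b f => fhom G (fhom F f))
    (functor_comp_id G F) (functor_comp_comp G F).

Definition is_iso (C : category) (a b : C) (f : hom a b) : Prop :=
  exists2 g : hom b a, compm g f = idm a & compm f g = idm b.

Definition nat_isomorphic (C D : category) (F G : cfunctor C D) : Prop :=
  exists eta : forall a, hom (F a) (G a),
    (forall a, is_iso (eta a)) /\
    (forall a b (f : hom a b),
       compm (eta b) (fhom F f) = compm (fhom G f) (eta a)).

Definition equivalent_categories (C D : category) : Prop :=
  exists (F : cfunctor C D) (G : cfunctor D C),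
    nat_isomorphic (functor_comp G F) (functor_id C) /\
    nat_isomorphic (functor_comp F G) (functor_id D).

Lemma CkW (R : realType) (V W : normedModType R) (k : nat) (U U' : set V)
  (f : V -> W) : U' `<=` U -> Ck k U f -> Ck k U' f.
Proof.
move=> UU'; elim: k f => [|k IH] f /= H.
  by move=> x /UU'; exact: H.
by case: H => H1 H2; split=> [x /UU'|v]; [exact: H1|exact: IH].
Qed.

Lemma near_eq_differentiable (R : realType) (V W : normedModType R)
  (f g : V -> W) (x : V) :
  (\near x, f x = g x) -> differentiable f x -> differentiable g x.
Proof.
move=> fg /diff_locallyP[cdf Hdf].
have fgx : f x = g x by exact: (nbhs_singleton fg).
have Hdg : g \o shift x = cst (g x) + 'd f x +o_ 0 id.
  apply/eqaddoP => e e0.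
  move/eqaddoP : Hdf => /(_ e e0) H.
  have fg' : \forall h \near (0 : V), f (h + x) = g (h + x).
    by move: fg; rewrite (near_shift 0) subr0.
  near=> h.
  have Hh : `|(f \o shift x - (cst (f x) + 'd f x)) h| <= e * `|id h|.
    by near: h.
  have fgh : f (h + x) = g (h + x) by near: h.
  by move: Hh; rewrite !fctE /= fgh fgx.
have dgf := diff_unique cdf Hdg.
apply/diff_locallyP; rewrite dgf; split=> //.
Unshelve. all: by end_near. Qed.

Lemma Ck_ext (R : realType) (V W : normedModType R) (k : nat) (U : set V)
  (f g : V -> W) : open U -> (forall x, U x -> f x = g x) ->
  Ck k U f -> Ck k U g.
Proof.
move=> oU; elim: k f g => [|k IH] f g fg.
all: have fgn : forall x, U x -> \forall y \near x, f y = g y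
  by move=> x Ux; apply: filterS (open_nbhs_nbhs (conj oU Ux)) => y; exact: fg.
- move=> H x Ux; rewrite /prop_for /continuous_at -(fg x Ux).
  by apply: cvg_trans (H x Ux); apply: near_eq_cvg; exact: fgn.
- move=> [H1 H2]; split=> [x Ux|v].
    by apply: near_eq_differentiable (fgn x Ux) (H1 x Ux).
  by apply: IH (H2 v) => x Ux; apply: near_eq_derive; exact: fgn.
Qed.

Lemma Ck_lin (R : realType) (V W : normedModType R) (k : nat) (U : set V)
  (a : R) (f g : V -> W) : open U ->
  Ck k U f -> Ck k U g -> Ck k U (a *: f + g).
Proof.
move=> oU; elim: k f g => [|k IH] f g.
  by move=> Hf Hg x Ux; apply: continuousD; [apply: continuousZl_tmp; exact: Hf|exact: Hg].
move=> [df Df] [dg Dg]; split=> [x Ux|v].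
  by apply: differentiableD; [apply: differentiableZ; exact: df|exact: dg].
apply: (Ck_ext oU) (IH _ _ (Df v) (Dg v)) => x Ux.
have := df x Ux => /diff_derivable dfv; have := dg x Ux => /diff_derivable dgv.
by rewrite deriveD ?deriveZ//; exact: derivableZ.
Qed.

Lemma smooth_at_lin (R : realType) (M : preManifold R) (p : M) (a : R)
  (f g : M -> R) : smooth_at p f -> smooth_at p g ->
  smooth_at p (fun x => a * f x + g x).
Proof.
move=> Hf Hg c ac cp.
have [W [oW Wp Wf]] := Hf c ac cp; have [W' [oW' Wp' Wg]] := Hg c ac cp.
exists (W `&` W'); split=> [||k]; [exact: openI|by []|].
apply: (@Ck_lin _ _ _ k _ a (f \o cinv c) (g \o cinv c)); first exact: openI.
  by apply: CkW (Wf k) => x [].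
by apply: CkW (Wg k) => x [].
Qed.

Lemma smooth_atD (R : realType) (M : preManifold R) (p : M) (f g : M -> R) :
  smooth_at p f -> smooth_at p g -> smooth_at p (fun x => f x + g x).
Proof.
move=> Hf Hg; have := smooth_at_lin 1 Hf Hg.
by under eq_fun do rewrite mul1r.
Qed.

Lemma smooth_at0 (R : realType) (M : preManifold R) (p : M) :
  smooth_at p (fun=> 0 : R).
Proof.
move=> c ac cp; exists setT; split=> [||k]; [exact: openT|by []|].
rewrite /comp/=; elim: k => [|k IH]/=.
  by move=> x _; exact: cst_continuous.
split=> [x _|v]; first exact: differentiable_cst.
by under eq_fun do rewrite derive_cst.
Qed.

Lemma smooth_atN (R : realType) (M : preManifold R) (p : M) (f : M -> R) :
  smooth_at p f -> smooth_at p (fun x => - f x).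
Proof.
move=> Hf; have := smooth_at_lin (-1) Hf (@smooth_at0 _ M p).
by under eq_fun do rewrite mulN1r addr0.
Qed.

Lemma tangentD (R : realType) (M : preManifold R) (p : M) (v : tvec M)
  (f g : M -> R) : tangent p v -> smooth_at p f -> smooth_at p g ->
  v (fun x => f x + g x) = v f + v g.
Proof.
move=> [_ + _] Hf Hg => /(_ 1 f g Hf Hg).
by rewrite mul1r => <-; congr v; apply/funext => x; rewrite mul1r.
Qed.

Lemma tangent0 (R : realType) (M : preManifold R) (p : M) :
  tangent p (0 : tvec M).
Proof.
have E f : (0 : tvec M) f = 0 by [].
by split=> [f _|a f g _ _|f g _ _]; rewrite !E ?mulr0 ?mul0r ?addr0.
Qed.

Lemma tangent_lin (R : realType) (M : preManifold R) (p : M) (a : R)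
  (v w : tvec M) : tangent p v -> tangent p w -> tangent p (a *: v + w).
Proof.
have E f : (a *: v + w) f = a * v f + w f by [].
move=> [v0 vD vM] [w0 wD wM]; split=> [f nf|b f g Hf Hg|f g Hf Hg]; rewrite !E.
- by rewrite v0// w0// mulr0 addr0.
- by rewrite vD// wD//; ring.
- by rewrite vM// wM//; ring.
Qed.

Lemma cotangentD (R : realType) (M : preManifold R) (p : M) (b b' : covec M) :
  cotangent p b -> cotangent p b' -> cotangent p (b + b').
Proof.
have E v : (b + b') v = b v + b' v by [].
move=> [b0 bl] [c0 cl]; split=> [v nv|a v w tv tw]; rewrite !E.
  by rewrite b0// c0// addr0.
by rewrite bl// cl//; ring.
Qed.

Lemma cotangentN (R : realType) (M : preManifold R) (p : M) (b : covec M) :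
  cotangent p b -> cotangent p (- b).
Proof.
have E v : (- b) v = - b v by [].
move=> [b0 bl]; split=> [v nv|a v w tv tw]; rewrite !E.
  by rewrite b0// oppr0.
by rewrite bl//; ring.
Qed.

Lemma cotangent_sum (R : realType) (M : preManifold R) (p : M) (b : covec M)
  (n : nat) (c : 'I_n -> R) (v : 'I_n -> tvec M) : cotangent p b ->
  (forall i, tangent p (v i)) ->
  tangent p (\sum_i c i *: v i) /\ b (\sum_i c i *: v i) = \sum_i c i * b (v i).
Proof.
move=> [b0 bl] tv.
have z : b 0 = 0.
  have := bl 1 _ _ (@tangent0 _ M p) (@tangent0 _ M p).
  rewrite scale1r addr0 mul1r => /(congr1 (fun x => x - b 0)).
  by rewrite subrr addrK.
elim/big_rec2 : _ => [|i y x _ [tx bx]]; first by split; [exact: tangent0|].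
by split; [exact: tangent_lin|rewrite bl// bx].
Qed.
Lemma CkS (R : realType) (V W : normedModType R) (k : nat) (U : set V)
  (f : V -> W) : Ck k.+1 U f -> Ck k U f.
Proof.
elim: k f => [|k IH] f [df Df].
  by move=> x Ux; apply: differentiable_continuous; exact: df.
by split=> // v; apply: IH; exact: Df.
Qed.

Lemma CkM (R : realType) (V : normedModType R) (k : nat) (U : set V)
  (f g : V -> R) : open U -> Ck k U f -> Ck k U g -> Ck k U (f * g).
Proof.
move=> oU; elim: k f g => [|k IH] f g Hf Hg.
  by move=> x Ux; apply: continuousM; [exact: Hf|exact: Hg].
have [Hf' Hg'] := (CkS Hf, CkS Hg).
case: Hf Hg => [df Df] [dg Dg]; split=> [x Ux|v].
  by apply: differentiableM; [exact: df|exact: dg].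
have H : Ck k U (1 *: (f * (fun x => 'D_v g x)) + g * (fun x => 'D_v f x)).
  by apply: (Ck_lin _ oU); [exact: IH Hf' (Dg v)|exact: IH Hg' (Df v)].
apply: (Ck_ext oU _ H) => x Ux.
rewrite scale1r deriveM //; first exact/diff_derivable/df.
exact/diff_derivable/dg.
Qed.

Lemma smooth_atM (R : realType) (M : preManifold R) (p : M) (f g : M -> R) :
  smooth_at p f -> smooth_at p g -> smooth_at p (fun x => f x * g x).
Proof.
move=> Hf Hg c ac cp.
have [W [oW Wp Wf]] := Hf c ac cp; have [W' [oW' Wp' Wg]] := Hg c ac cp.
exists (W `&` W'); split=> [||k]; [exact: openI|by []|].
apply: (@CkM _ _ k _ (f \o cinv c) (g \o cinv c)); first exact: openI.
  by apply: CkW (Wf k) => x [].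
by apply: CkW (Wg k) => x [].
Qed.

Lemma vfieldW (R : realType) (M : preManifold R) (U V : set M)
  (X : M -> tvec M) : V `<=` U -> vfield_on U X -> vfield_on V X.
Proof. by move=> VU HX x /VU; exact: HX. Qed.

Lemma one_form_onD (R : realType) (M : preManifold R) (U : set M)
  (a b : M -> covec M) : one_form_on U a -> one_form_on U b ->
  one_form_on U (fun x => a x + b x).
Proof.
move=> [ca sa] [cb sb]; split=> [x Ux|V X oV HX x Ux Vx].
  by apply: cotangentD; [exact: ca|exact: cb].
by apply: smooth_atD; [exact: sa HX _ Ux Vx|exact: sb HX _ Ux Vx].
Qed.

Lemma one_form_onN (R : realType) (M : preManifold R) (U : set M)
  (a : M -> covec M) : one_form_on U a -> one_form_on U (fun x => - a x).
Proof.
move=> [ca sa]; split=> [x Ux|V X oV HX x Ux Vx].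
  by apply: cotangentN; exact: ca.
by apply: smooth_atN; exact: sa HX _ Ux Vx.
Qed.

Section gauge.
Variables (R : realType) (M : preManifold R) (D : diracStructure M).
Variables (B : M -> tvec M -> covec M) (clB : closed_two_form B).

Let BB : two_form B := proj1 clB.

Let Bcot x v : cotangent x (B x v).
Proof. by case: BB. Qed.

Let Bcot' x w : cotangent x ((fun v => B x v w) : covec M).
Proof. by case: BB. Qed.

Let Banti x v w : B x v w = - B x w v.
Proof.
have [tv|ntv] := pselect (tangent x v); last first.
  by rewrite (proj1 (Bcot x w)) // (proj1 (Bcot' x w)) // oppr0.
have [tw|ntw] := pselect (tangent x w); last first.
  by rewrite (proj1 (Bcot x v)) // (proj1 (Bcot' x v)) // oppr0.
have alt : forall u, B x u u = 0 by case: BB.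
have twv : tangent x (1 *: v + w) by exact: tangent_lin.
have := alt (1 *: v + w).
rewrite (proj2 (Bcot x _)) // (proj2 (Bcot' x v)) // (proj2 (Bcot' x w)) //.
rewrite !alt !mul1r addr0 add0r => /eqP.
by rewrite addrC addr_eq0 => /eqP.
Qed.

Let iform (U : set M) X : open U -> vfield_on U X ->
  one_form_on U (fun x => B x (X x)).
Proof.
move=> oU HX; split=> // V Y oV HY x Ux Vx.
case: BB => _ _ _; apply; [exact: (openI oU oV)| | |by []].
  by apply: vfieldW HX => y [].
by apply: vfieldW HY => y [].
Qed.

Lemma gauge_sub x s : gauge_fib D B x s -> tangent x s.1 /\ cotangent x s.2.
Proof.
by move=> [s' /dirac_sub[t c] <-]; split=> //=; exact: cotangentD.
Qed.

Lemma gauge_isotropic x s t : gauge_fib D B x s -> gauge_fib D B x t ->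
  t.2 s.1 + s.2 t.1 = 0.
Proof.
move=> [s' Ds <-] [t' Dt <-] /=; have := dirac_isotropic Ds Dt.
have E (b c : covec M) v : (b + c) v = b v + c v by [].
rewrite !E (Banti x t'.1 s'.1) => <-; ring.
Qed.

Let twist (x : M) (s : gtvec M) : gtvec M := (s.1, s.2 + B x s.1).

Let twist_sum x n (c : 'I_n -> R) (e : 'I_n -> gtvec M) :
  (forall i, tangent x (e i).1) ->
  \sum_i c i *: twist x (e i) = twist x (\sum_i c i *: e i).
Proof.
move=> te.
have E1 (f : 'I_n -> gtvec M) :
    (\sum_i c i *: f i).1 = \sum_i c i *: (f i).1.
  by elim/big_rec2 : _ => // i y z _ <-.
have E2 (f : 'I_n -> gtvec M) :
    (\sum_i c i *: f i).2 = \sum_i c i *: (f i).2.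
  by elim/big_rec2 : _ => // i y z _ <-.
apply: injective_projections; rewrite /= E1.
  by rewrite E1.
rewrite !E2 /=; apply/funext => w.
have E (b b' : covec M) v : (b + b') v = b v + b' v by [].
have ES (f : 'I_n -> covec M) : (\sum_i c i *: f i) w = \sum_i c i * f i w.
  by elim/big_rec2 : _ => // i y z _ <-.
rewrite E !ES (cotangent_sum c (Bcot' x w) te).2 -big_split /=.
by apply: eq_bigr => i _; rewrite E mulrDr.
Qed.

Let twist_inj x : injective (twist x).
Proof. by move=> [v b] [v' b'] [<- /addIr <-]. Qed.

Lemma gauge_subbundle x : exists U : set M,
  [/\ open U, U x & exists e : 'I_(dimM M) -> M -> gtvec M,
      frame_on U (gauge_fib D B) e].
Proof.
have [U [oU Ux [e [se De fe]]]] := dirac_subbundle D x.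
exists U; split=> //; exists (fun i y => twist y (e i y)); split.
- move=> i; split; first by case: (se i).
  by apply: one_form_onD; [case: (se i)|apply: iform => //; case: (se i)].
- move=> y Uy; have te i : tangent y (e i y).1 by case: (se i) => /(_ y Uy)[].
  rewrite /gauge_fib De //; apply/seteqP; split=> s /=.
    by move=> [_ [c ->] <-]; exists c; rewrite twist_sum.
  by move=> [c ->]; exists (\sum_i c i *: e i y); [exists c|rewrite twist_sum].
- move=> y Uy c; have te i : tangent y (e i y).1 by case: (se i) => /(_ y Uy)[].
  rewrite twist_sum // => c0; apply: (fe y Uy); apply: (@twist_inj y).
  rewrite c0 /twist /=; congr pair; apply/esym/funext => w.
  have E (b : covec M) v : (0 + b) v = b v by rewrite add0r.
  rewrite E; have [_ /(_ 1 _ _ (@tangent0 _ M y) (@tangent0 _ M y))] := Bcot' y w.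
  rewrite scale1r addr0 mul1r => /(congr1 (fun z => z - B y 0 w)).
  by rewrite subrr addrK => <-.
Qed.

Lemma gauge_involutive s t :
  section_of (gauge_fib D B) s -> section_of (gauge_fib D B) t ->
  exists2 r, section_of (gauge_fib D B) r & is_bracket s t r.
Proof.
pose untw (u : M -> gtvec M) (x : M) : gtvec M :=
  ((u x).1, (u x).2 - B x (u x).1).
have untwE u x : u x = twist x (untw u x).
  by rewrite /twist /untw /= subrK; case: (u x).
have untwP u : section_of (gauge_fib D B) u -> section_of D (untw u).
  move=> [[u1 u2] Du]; split; first split=> //=.
    apply: one_form_onD => //; apply: one_form_onN; apply: iform => //.
    exact: openT.
  move=> x; have [d Dd ud] := Du x.
  suff -> : untw u x = d by [].
  by apply: (@twist_inj x); rewrite -untwE -ud.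
move=> Hs Ht; have [Hs' Ht'] := (untwP _ Hs, untwP _ Ht).
have [r [[r1 r2] Dr] [br1 br2]] := dirac_involutive Hs' Ht'.
exists (fun x => twist x (r x)).
  split; last by move=> x; exists (r x).
  by split=> //=; apply: one_form_onD => //; apply: iform => //; exact: openT.
split=> [p|O Z oO HZ p Op]; first exact: br1.
pose U := fun x => (s x).1; pose V := fun x => (t x).1.
pose a := fun x => (untw s x).2; pose b := fun x => (untw t x).2.
have r1E : (r p).1 = lie U V p := br1 p.
have r2E : (r p).2 (Z p) = U p (fun q => b q (Z q)) - b p (lie U Z p) -
  (V p (fun q => a q (Z q)) - Z p (fun q => a q (V q)) - a p (lie V Z p)) :=
  br2 O Z oO HZ p Op.
have HU : vfield_on O U by apply: vfieldW Hs.1.1.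
have HV : vfield_on O V by apply: vfieldW Ht.1.1.
have E (c c' : covec M) v : (c + c') v = c v + c' v by [].
have sE q w : (s q).2 w = a q w + B q (U q) w by rewrite {1}untwE.
have tE q w : (t q).2 w = b q w + B q (V q) w by rewrite {1}untwE.
have sa X : vfield_on O X -> smooth_at p (fun q => a q (X q)).
  by move=> HX; exact: (proj2 Hs'.1.2 O X oO HX p I Op).
have sb X : vfield_on O X -> smooth_at p (fun q => b q (X q)).
  by move=> HX; exact: (proj2 Ht'.1.2 O X oO HX p I Op).
have sB X Y : vfield_on O X -> vfield_on O Y ->
    smooth_at p (fun q => B q (X q) (Y q)).
  by move=> HX HY; case: BB => _ _ _ H; exact: (H O X Y oO HX HY p Op).
have e1 : U p (fun q => (t q).2 (Z q)) =
    U p (fun q => b q (Z q)) + U p (fun q => B q (V q) (Z q)).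
  rewrite -(tangentD (HU p Op).1 (sb _ HZ) (sB _ _ HV HZ)); congr (U p).
  by apply/funext => q; exact: tE.
have e2 : V p (fun q => (s q).2 (Z q)) =
    V p (fun q => a q (Z q)) + V p (fun q => B q (U q) (Z q)).
  rewrite -(tangentD (HV p Op).1 (sa _ HZ) (sB _ _ HU HZ)); congr (V p).
  by apply/funext => q; exact: sE.
have e3 : Z p (fun q => (s q).2 (V q)) =
    Z p (fun q => a q (V q)) + Z p (fun q => B q (U q) (V q)).
  rewrite -(tangentD (HZ p Op).1 (sa _ HV) (sB _ _ HU HV)); congr (Z p).
  by apply/funext => q; exact: sE.
have := clB.2 O U V Z oO HU HV HZ p Op; rewrite /ext_deriv2.
rewrite (Banti p (lie U Z p)) (Banti p (lie V Z p)) => dB0.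
change (((r p).2 + B p (r p).1) (Z p) =
  U p (fun q => (t q).2 (Z q)) - (t p).2 (lie U Z p) -
  (V p (fun q => (s q).2 (Z q)) - Z p (fun q => (s q).2 (V q)) -
   (s p).2 (lie V Z p))).
rewrite E r2E r1E e1 e2 e3 sE tE.
apply/eqP; rewrite -subr_eq0 -oppr_eq0 -dB0; apply/eqP; ring.
Qed.

Definition gaugeDirac : diracStructure M :=
  Dirac gauge_sub gauge_isotropic gauge_subbundle gauge_involutive.

End gauge.

Lemma smooth_map_id (R : realType) (M : preManifold R) : smooth_map (@id M).
Proof. by split=> // x; exact: cvg_id. Qed.

Lemma smooth_map_comp (R : realType) (N M P : preManifold R) (G : M -> P)
  (F : N -> M) : smooth_map G -> smooth_map F -> smooth_map (G \o F).
Proof.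
move=> [cG sG] [cF sF]; split=> [x|n g Hg].
  by apply: continuous_comp; [exact: cF|exact: cG].
by apply: (sF n (g \o G)); exact: sG.
Qed.

Lemma dmap_id (R : realType) (M : preManifold R) (p : M) (v : tvec M) :
  tangent p v -> dmap id p v = v.
Proof.
move=> [v0 _ _]; apply/funext => g; rewrite /dmap.
by case: asboolP => // ng; rewrite v0.
Qed.

Lemma dmap_comp (R : realType) (N M P : preManifold R) (G : M -> P)
  (F : N -> M) (n : N) (v : tvec N) : smooth_map G ->
  dmap (G \o F) n v = dmap G (F n) (dmap F n v).
Proof.
move=> [_ sG]; apply/funext => g; rewrite /dmap /=.
by case: asboolP => // Hg; rewrite asboolT //; exact: sG.
Qed.

Lemma tangent_dmap (R : realType) (N M : preManifold R) (F : N -> M) (n : N)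
  (v : tvec N) : smooth_map F -> tangent n v -> tangent (F n) (dmap F n v).
Proof.
move=> [_ sF] [v0 vD vM]; split=> [f nf|a f g Hf Hg|f g Hf Hg].
- by rewrite /dmap asboolF.
- rewrite /dmap !asboolT //; last exact: smooth_at_lin.
  by rewrite -vD //; exact: sF.
- rewrite /dmap !asboolT //; last exact: smooth_atM.
  by rewrite -(vM (f \o F) (g \o F)) //; exact: sF.
Qed.

Lemma comap_id (R : realType) (M : preManifold R) (p : M) (b : covec M) :
  cotangent p b -> comap id p b = b.
Proof.
move=> [b0 _]; apply/funext => v; rewrite /comap.
by case: asboolP => [tv|nv]; [rewrite dmap_id|rewrite b0].
Qed.

Lemma comap_comp (R : realType) (N M P : preManifold R) (G : M -> P)
  (F : N -> M) (n : N) (b : covec P) : smooth_map G -> smooth_map F ->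
  comap (G \o F) n b = comap F n (comap G (F n) b).
Proof.
move=> sG sF; apply/funext => v; rewrite /comap.
case: asboolP => [tv|_]; last by [].
have tw := tangent_dmap sF tv.
by rewrite (asboolT tw) (dmap_comp F n v sG).
Qed.

Lemma dmap_lin (R : realType) (N M : preManifold R) (F : N -> M) (n : N) (a : R)
  (v w : tvec N) : dmap F n (a *: v + w) = a *: dmap F n v + dmap F n w.
Proof.
apply/funext => g.
have E (T : preManifold R) (v' w' : tvec T) h : (a *: v' + w') h = a * v' h + w' h by [].
by rewrite E /dmap; case: asboolP => // _; rewrite mulr0 addr0.
Qed.

Lemma cotangent_comap (R : realType) (N M : preManifold R) (F : N -> M) (n : N)
  (b : covec M) : smooth_map F -> cotangent (F n) b -> cotangent n (comap F n b).
Proof.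
move=> sF [b0 bl]; split=> [v nv|a v w tv tw]; rewrite /comap.
  by rewrite asboolF.
rewrite !asboolT //; last exact: tangent_lin.
by rewrite dmap_lin bl //; exact: tangent_dmap.
Qed.

Lemma forward_dirac_id (R : realType) (M : preManifold R)
  (D : diracStructure M) : forward_dirac D D id.
Proof.
split; first exact: smooth_map_id.
move=> p; apply/seteqP; split=> [[v b] Ds|s [v [b [-> tv cb]]]] /=.
  have [tv cb] := dirac_sub Ds.
  by exists v, b; split=> //; rewrite ?dmap_id ?comap_id.
by rewrite dmap_id // comap_id.
Qed.

Lemma forward_dirac_comp (R : realType) (N M P : preManifold R)
  (DN : diracStructure N) (DM : diracStructure M) (DP : diracStructure P)
  (G : M -> P) (F : N -> M) :
  forward_dirac DM DP G -> forward_dirac DN DM F -> forward_dirac DN DP (G \o F).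
Proof.
move=> [sG dG] [sF dF]; split; first exact: smooth_map_comp.
move=> n; rewrite /= dG; apply/seteqP; split=> s /=.
- move=> [v [b [-> tv cb]]]; rewrite dF => -[w [b' [[vw <-] tw cb' Dw]]].
  exists w, b; split=> //; first by rewrite vw dmap_comp.
  by rewrite comap_comp.
- move=> [v [b [-> tv cb Dv]]]; exists (dmap F n v), b; split=> //.
  + by rewrite dmap_comp.
  + exact: tangent_dmap.
  + rewrite dF; exists v, (comap G (F n) b); split=> //.
      exact: cotangent_comap.
    by rewrite -comap_comp.
Qed.

Record hamObject (R : realType) (M : manifold R) (D : diracStructure M) :=
  HamObject {
    ham_space : manifold R;
    ham_dirac : diracStructure ham_space;
    ham_map : ham_space -> M;
    ham_strong : strong_dirac ham_dirac D ham_map;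
    ham_complete : complete_dirac ham_dirac D ham_map;
    ham_surjective : forall m, exists n, ham_map n = m;
    ham_submersion : submersion ham_map }.
Arguments ham_map {R M D} h _.

Definition hamHom (R : realType) (M : manifold R) (D : diracStructure M)
    (X Y : hamObject D) : Type :=
  {f : ham_space X -> ham_space Y |
    forward_dirac (ham_dirac X) (ham_dirac Y) f /\ ham_map X = ham_map Y \o f}.

Section hamCategory.
Variables (R : realType) (M : manifold R) (D : diracStructure M).
Implicit Types X Y Z W : hamObject D.

Definition hamId X : hamHom X X :=
  exist _ id (conj (forward_dirac_id (ham_dirac X)) erefl).

Lemma hamComp_subproof X Y Z (g : hamHom Y Z) (f : hamHom X Y) :
  forward_dirac (ham_dirac X) (ham_dirac Z) (sval g \o sval f) /\
  ham_map X = ham_map Z \o (sval g \o sval f).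
Proof.
case: g f => [g [dg eg]] [f [df ef]] /=; split.
  exact: forward_dirac_comp dg df.
by rewrite ef eg.
Qed.

Definition hamComp X Y Z (g : hamHom Y Z) (f : hamHom X Y) : hamHom X Z :=
  exist _ (sval g \o sval f) (hamComp_subproof g f).

Lemma hamHom_inj X Y (f g : hamHom X Y) : sval f = sval g -> f = g.
Proof.
case: f g => [f pf] [g pg] /= fg; subst g.
by congr exist; exact: Prop_irrelevance.
Qed.

Lemma hamComp_idl X Y (f : hamHom X Y) : hamComp (hamId Y) f = f.
Proof. exact: hamHom_inj. Qed.

Lemma hamComp_idr X Y (f : hamHom X Y) : hamComp f (hamId X) = f.
Proof. exact: hamHom_inj. Qed.

Lemma hamComp_assoc X Y Z W (h : hamHom Z W) (g : hamHom Y Z)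
  (f : hamHom X Y) : hamComp h (hamComp g f) = hamComp (hamComp h g) f.
Proof. exact: hamHom_inj. Qed.

Definition hamCategory : category :=
  Category hamComp_idl hamComp_idr hamComp_assoc.

End hamCategory.

(* Main.v *)
(** Gauging by B is undone by gauging by -B, so it suffices to turn an object
    F : (N, D_N) -> (M, D_M) into the object F : (N, tau_(F^*B) D_N) ->
    (M, tau_B D_M): same manifold, same map.  A vector V on N and a covector
    beta on M satisfy (V, F^*beta) \in tau_(F^*B) D_N if and only if
    (V, F^*(beta - i_(dF V) B)) \in D_N; hence forward Dirac maps, kernels and
    the infinitesimal actions zeta (so completeness) correspond, and morphisms
    are left unchanged because F = F' \o phi gives F^*B = phi^*(F'^*B).

    The analytic content is that F^*B is again a closed 2-form, although
    smoothness and closedness are only tested on vector fields of M, to which dF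
    does not send vector fields of N.  Hadamard's lemma shows that the
    coordinate fields of a chart span all derivations, which gives a local
    expression of F^*B in the functions B(d_i, d_j) \o F and x_i \o F. *)

Require Import Defs.
From HB Require Import structures.
From mathcomp Require Import all_boot all_order all_algebra.
From mathcomp Require Import all_classical all_reals all_analysis.
From mathcomp Require Import ring.
Import Order.TTheory GRing.Theory Num.Theory.
Import numFieldNormedType.Exports.

Set Implicit Arguments.
Unset Strict Implicit.
Unset Printing Implicit Defensive.

Local Open Scope classical_set_scope.
Local Open Scope ring_scope.

(** * Hadamard's lemma *)

Section unitIntegral.
Variable R : realType.
Implicit Types f g : R -> R.

Definition int01 f : R := \int[lebesgue_measure]_(t in `[0, 1]) f t.

Lemma integrable01 f : {in `[0, 1], continuous f} ->
  (lebesgue_measure : measure _ _).-integrable `[0, 1] (EFin \o f).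
Proof.
move=> cf; apply: continuous_compact_integrable; first exact: segment_compact.
exact: continuous_subspace_itv.
Qed.

Lemma int01_lin (a : R) f g :
  {in `[0, 1], continuous f} -> {in `[0, 1], continuous g} ->
  int01 (fun t => a * f t + g t) = a * int01 f + int01 g.
Proof.
move=> cf cg; rewrite /int01 RintegralD//; last 2 first.
- apply: integrable01 => t t01; apply: continuousM; last exact: cf.
  exact: cst_continuous.
- exact: integrable01.
by rewrite RintegralZl//; exact: integrable01.
Qed.

Lemma int01_le f (e : R) : {in `[0, 1], continuous f} ->
  (forall t, 0 <= t <= 1 -> `|f t| <= e) -> `|int01 f| <= e.
Proof.
move=> cf fe; have intf := integrable01 cf.
apply: (le_trans (le_normr_Rintegral _ _)) => //.
have -> : e = \int[lebesgue_measure]_(t in `[(0:R), 1]) (cst e t).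
  rewrite Rintegral_cst//= lebesgue_measure_itv/= lte_fin ltr01.
  by rewrite oppr0 adde0 mulr1.
apply: le_Rintegral => //.
- apply: (@integrable01 (fun t => `|f t|)) => t t01.
  by apply: continuous_comp; [exact: cf|exact: norm_continuous].
- by apply: integrable01 => t _; exact: cst_continuous.
Qed.

Lemma int01_FTC f g : {in `[0, 1], continuous f} ->
  {in `[0, 1], forall t, is_derive t (1 : R) g (f t)} ->
  int01 f = g 1 - g 0.
Proof.
move=> cf dg.
have cg t : t \in `[0, 1] -> {for t, continuous g}.
  move=> t01; have [+ _] := dg t t01.
  by move=> /derivable1_diffP/differentiable_continuous.
rewrite /int01 /Rintegral (@continuous_FTC2 _ f g) ?ltr01//.
- exact: continuous_subspace_itv.
- split.
  + move=> t t01; have [] := dg t _ => //.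
    exact: subset_itv_oo_cc.
  + by apply: cvg_at_right_filter; apply: cg; rewrite in_itv/= lexx ler01.
  + by apply: cvg_at_left_filter; apply: cg; rewrite in_itv/= lexx ler01.
- move=> t t01; rewrite derive1E; have /dg[_ ->//] : t \in `[0, 1].
  exact: subset_itv_oo_cc.
Qed.

End unitIntegral.

(** Quantifying over all orders absorbs the loss of one derivative, so smoothness passes to
    directional derivatives with no order to track. *)
Lemma smooth_onS (R : realType) (V W : normedModType R) (U : set V)
  (f : V -> W) : smooth_on U f <->
  (forall x, U x -> differentiable f x) /\
  (forall v, smooth_on U (fun x => 'D_v f x)).
Proof.
split=> [sf|[df Df] [|k]]; last by split=> // v; exact: Df.
  by split=> [|v k]; [exact: (sf 1%N).1|exact: (sf k.+1).2].
by move=> x Ux; apply: differentiable_continuous; exact: df.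
Qed.

(** * Calculus of [Ck] functions into and out of row vectors *)

Section CkRow.
Variables (R : realType) (n : nat).
Local Notation V := 'rV[R]_n.

Lemma derive_rVE (f : V -> R) (x v : V) : differentiable f x ->
  'D_v f x = \sum_(i < n) v 0 i * 'D_(delta_mx 0 i) f x.
Proof.
move=> df; rewrite deriveE// {1}(row_sum_delta v) linear_sum.
by apply: eq_bigr => i _; rewrite linearZ/= deriveE.
Qed.

Lemma Ck_cst (W W' : normedModType R) k (U : set W) (a : W') :
  Ck k U (fun=> a).
Proof.
elim: k a => [|k IH] a /=; first by move=> x _; exact: cst_continuous.
split=> [x _|v]; first exact: differentiable_cst.
by under eq_fun do rewrite derive_cst; exact: IH.
Qed.

Lemma Ck_sum (W : normedModType R) m k (U : set W) (f : 'I_m -> W -> R) :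
  open U -> (forall i, Ck k U (f i)) -> Ck k U (fun x => \sum_(i < m) f i x).
Proof.
move=> oU; elim: m f => [|m IH] f Hf.
  by under eq_fun do rewrite big_ord0; exact: Ck_cst.
under eq_fun do rewrite big_ord_recl.
have := Ck_lin 1 oU (Hf ord0) (IH _ (fun i => Hf (lift ord0 i))).
by apply: Ck_ext => // x Ux /=; rewrite scale1r.
Qed.

Lemma Ck_coord (W : normedModType R) k (U : set W) (T : W -> V) i :
  open U -> Ck k U T -> Ck k U (fun x => T x 0 i).
Proof.
move=> oU; elim: k T => [|k IH] T.
  move=> cT x Ux; apply: (@continuous_comp _ _ _ T (fun M : V => M 0 i)).
    exact: cT.
  exact: coord_continuous.
move=> [dT DT]; split=> [x Ux|v].
  apply: (@differentiable_comp _ _ _ _ T (fun M : V => M 0 i)); first exact: dT.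
  exact: differentiable_coord.
apply: (Ck_ext oU _ (IH _ (DT v))) => x Ux.
by rewrite derive_mx ?mxE//; exact/diff_derivable/dT.
Qed.

(** Induction on the order with [T] fixed. The chain rule expands the derivative over the
    coordinates of the row space into products of a component of ['D_v T] and a partial derivative
    of [g] composed with [T]; the induction hypothesis covers the latter. *)
Lemma Ck_comp (W : normedModType R) k (U : set W) (U' : set V) (T : W -> V)
  (g : V -> R) : open U -> (forall x, U x -> U' (T x)) ->
  Ck k U T -> Ck k U' g -> Ck k U (g \o T).
Proof.
move=> oU UU'; elim: k g => [|k IH] g.
  by move=> cT cg x Ux; apply: continuous_comp; [exact: cT|exact/cg/UU'].
move=> CT Cg; have [[dT DT] [dg Dg]] := (CT, Cg); split=> [x Ux|v].
  by apply: differentiable_comp; [exact: dT|exact/dg/UU'].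
pose h i : W -> R :=
  (fun x => 'D_v T x 0 i) * ('D_(delta_mx 0 i) g \o T).
have Ch : Ck k U (fun x => \sum_i h i x).
  apply: Ck_sum => // i; apply: CkM => //; first exact: (Ck_coord i oU (DT v)).
  by apply: IH; [exact: CkS|exact: Dg].
apply: (Ck_ext oU _ Ch) => x Ux.
have [dTx dgx] := (dT x Ux, dg _ (UU' x Ux)).
rewrite [RHS]deriveE; last exact: differentiable_comp.
by rewrite diff_comp//= -!deriveE// derive_rVE.
Qed.

End CkRow.

(** * Weighted averages along segments issuing from [a] *)

Section Hadamard.
Variables (R : realType) (n : nat) (a : 'rV[R]_n) (U : set 'rV[R]_n).
Local Notation V := 'rV[R]_n.
Implicit Types (f : V -> R) (x : V).

Definition seg x (t : R) : V := a + t *: (x - a).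

Hypotheses (oU : open U).
Hypothesis Useg : forall x (t : R), U x -> 0 <= t <= 1 -> U (seg x t).

(* The weight [t ^+ m] makes this family stable under differentiation:
   ['D_v (segint m f) = segint m.+1 ('D_v f)]. *)
Definition segint m f x : R := int01 (fun t => t ^+ m * f (seg x t)).

Lemma seg_continuous x : continuous (seg x).
Proof.
move=> t; apply: cvgD; first exact: cvg_cst.
by apply: cvgZr_tmp; exact: cvg_id.
Qed.

Lemma segD x h t : seg (h + x) t = t *: h + seg x t.
Proof. by rewrite /seg addrCA -scalerDr addrA. Qed.

Lemma segint_continuous m f x : U x ->
  (forall y, U y -> {for y, continuous f}) ->
  {in `[0, 1], continuous (fun t : R => t ^+ m * f (seg x t))}.
Proof.
move=> Ux cf t; rewrite in_itv/= => t01; apply: cvgM.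
  exact: exprn_continuous.
by apply: continuous_comp; [exact: seg_continuous|apply: cf; exact: Useg].
Qed.

(** Compactness of the unit interval makes the neighbourhood of 0 independent of [t]. The scaling by
    [s] covers the whole segment from [seg x t] to [h + seg x t], along which the mean value theorem
    is applied later. *)
Lemma near_seg_unif f x (e : R) : 0 < e -> U x ->
  (forall y, U y -> {for y, continuous f}) ->
  \forall h \near (0 : V), forall t s : R, 0 <= t <= 1 -> 0 <= s <= 1 ->
    U (s *: h + seg x t) /\ `|f (s *: h + seg x t) - f (seg x t)| <= e.
Proof.
move=> e0 Ux cf.
pose P (h : V) (t : R) := forall s, 0 <= s <= 1 ->
    U (s *: h + seg x t) /\ `|f (s *: h + seg x t) - f (seg x t)| <= e.
have /compact_near_coveringP cov := @segment_compact R 0 1.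
have : \forall h \near (0 : V), `[(0 : R), 1]%classic `<=` P h.
  apply: (cov V (nbhs (0 : V)) P) => t /=.
  rewrite in_itv/= => t01; set y := seg x t.
  have Uy : U y by exact: Useg.
  have : \forall z \near y, U z /\ `|f y - f z| < e / 2.
    near=> z; split; first by near: z; exact: open_nbhs_nbhs.
    by near: z; move/cvgrPdist_lt : (cf y Uy); apply; rewrite divr_gt0.
  move=> /nbhs_ballP[d /= d0 dP].
  (* Half of the radius [d] pays for moving [t] to [t'], the other half for the shift by
     [s *: h]. *)
  have nt : \forall t' \near t, `|y - seg x t'| < d / 2.
    by move/cvgrPdist_lt : (@seg_continuous x t); apply; rewrite divr_gt0.
  have nh : \forall h \near (0 : V), `|h| < d / 2.
    by apply: nbhs0_lt; rewrite divr_gt0.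
  exists ([set t' | `|y - seg x t'| < d / 2], [set h | `|h| < d / 2]) => //.
  move=> [t' h] [/= nt' nh'] s /andP[s0 s1].
  have [|_ Pt] := dP (seg x t').
    rewrite -ball_normE/=; apply: lt_trans nt' _.
    by rewrite ltr_pdivrMr// ltr_pMr ?ltr1n.
  have [|Us Ps] := dP (s *: h + seg x t').
    rewrite -ball_normE/= opprD addrCA.
    rewrite [d]splitr (le_lt_trans (ler_normD _ _))// ler_ltD//.
    rewrite normrN normrZ ger0_norm//; apply: le_trans (ltW nh').
    by rewrite ler_piMl.
  split=> //.
  rewrite -(subrKA (f y)) [e]splitr (le_trans (ler_normD _ _))// lerD//.
    by rewrite distrC ltW.
  exact: ltW.
apply: filterS => h Ph t s t01 s01.
by apply: Ph => //=; rewrite in_itv.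
Unshelve. all: by end_near. Qed.

Lemma mx_entry_le (h : V) i : `|h 0 i| <= `|h|.
Proof.
rewrite [leRHS]/Num.Def.normr/= mx_normrE.
exact: (le_bigmax _ (fun ij : 'I_1 * 'I_n => `|h ij.1 ij.2|) (0, i)).
Qed.

Lemma is_derive_line f (y h : V) (s : R) : differentiable f (s *: h + y) ->
  is_derive s (1 : R) (fun s => f (s *: h + y)) ('D_h f (s *: h + y)).
Proof.
move=> df.
have dl : is_diff s (fun s : R => s *: h + y) (fun u => u *: h).
  apply: is_diff_eq; apply/funext => u /=.
  by rewrite /= addr0.
have dfl : differentiable (f \o (fun s : R => s *: h + y)) s.
  exact: differentiable_comp.
apply: DeriveDef; first exact: diff_derivable.
rewrite -[LHS]/('D_1 (f \o (fun s : R => s *: h + y)) s).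
rewrite deriveE// diff_comp//=.
by rewrite diff_val scale1r deriveE.
Qed.

(** The mean value theorem replaces the increment by [t] times a value of ['D_h f] at an
    intermediate point. Expanding ['D_h f] in the [n] partial derivatives gives the factor [n], and
    only finitely many functions have to be controlled whatever the direction [h]. *)
Lemma increment_le f (y h : V) (e : R) :
  (forall s, 0 <= s <= 1 -> differentiable f (s *: h + y) /\
     forall i, `|'D_(delta_mx 0 i) f (s *: h + y)
                - 'D_(delta_mx 0 i) f y| <= e) ->
  forall t, 0 <= t <= 1 ->
    `|f (t *: h + y) - f y - t * 'D_h f y| <= n%:R * e * `|h|.
Proof.
move=> H t /andP[t0 t1].
have dfy : differentiable f y.
  by have [] := H 0; rewrite ?lexx ?ler01// scale0r add0r.
have dphi s : 0 <= s <= t ->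
    is_derive s (1 : R) (fun s => f (s *: h + y)) ('D_h f (s *: h + y)).
  move=> /andP[s0 st]; apply: is_derive_line.
  by have [|] := H s; rewrite ?s0 ?(le_trans st).
have [s| |c] := @MVT_segment R (fun s => f (s *: h + y))
  (fun s => 'D_h f (s *: h + y)) 0 t t0.
- by rewrite in_itv/= => /andP[s0 st]; apply: dphi; rewrite !ltW.
- apply: continuous_subspace_itv => s; rewrite in_itv/= => st.
  by have [/derivable1_diffP/differentiable_continuous] := dphi s st.
rewrite in_itv/= => /andP[c0 ct].
rewrite scale0r add0r subr0 => ->; rewrite mulrC -mulrBr normrM.
have [|dfc Hc] := H c; first by rewrite c0 (le_trans ct).
apply: (@le_trans _ _ (1 * `|'D_h f (c *: h + y) - 'D_h f y|)).
  by rewrite ler_wpM2r// ger0_norm.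
rewrite mul1r !derive_rVE// -sumrB (le_trans (ler_norm_sum _ _ _))//.
apply: (@le_trans _ _ (\sum_(i < n) (e * `|h|))).
  apply: ler_sum => i _; rewrite -mulrBr normrM mulrC.
  by apply: ler_pM => //; exact: mx_entry_le.
by rewrite sumr_const card_ord -mulrA mulr_natl.
Qed.

(** Continuity of the sum is proved along with its integral, because [int01_lin] asks for it in the
    inductive step. *)
Lemma int01_sum k (c : 'I_k -> R) (F : 'I_k -> R -> R) :
  (forall i, {in `[0, 1], continuous (F i)}) ->
  int01 (fun t => \sum_i c i * F i t) = \sum_i c i * int01 (F i) /\
  {in `[0, 1], continuous (fun t => \sum_i c i * F i t)}.
Proof.
elim: k c F => [|k IH] c F cF.
  have -> : (fun t => \sum_(i < 0) c i * F i t) = cst 0.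
    by apply/funext => t; rewrite big_ord0.
  rewrite big_ord0; split; last by move=> t _; exact: cst_continuous.
  by rewrite /int01 Rintegral_cst// mul0r.
have [IH1 IH2] := IH (fun i => c (lift ord0 i)) (fun i => F (lift ord0 i))
  (fun i => cF (lift ord0 i)).
have -> : (fun t => \sum_i c i * F i t) =
    (fun t => c ord0 * F ord0 t + \sum_i c (lift ord0 i) * F (lift ord0 i) t).
  by apply/funext => t; rewrite big_ord_recl.
split; first by rewrite int01_lin// IH1 big_ord_recl.
move=> t t01; apply: cvgD; last exact: IH2.
by apply: cvgM; [exact: cvg_cst|exact: cF].
Qed.

(** Differentiation under the integral sign: the first-order remainder of the integrand is small
    uniformly in [t], by [near_seg_unif] for the partial derivatives and [increment_le]. *)
Lemma segint_derive m f x : U x -> (forall y, U y -> differentiable f y) ->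
  (forall v y, U y -> {for y, continuous ('D_v f)}) ->
  differentiable (segint m f) x /\
  forall v, 'D_v (segint m f) x = segint m.+1 ('D_v f) x.
Proof.
move=> Ux df cDf; pose g := segint m f.
pose c i := segint m.+1 ('D_(delta_mx 0 i) f) x.
(* The candidate differential, expanded in partial derivatives so as to be visibly linear and
   continuous; [LE] identifies it with [segint m.+1 ('D_h f) x]. *)
pose L (h : V) := \sum_i h 0 i * c i.
have segU t : t \in `[0, 1] -> U (seg x t).
  by rewrite in_itv/= => t01; exact: Useg.
have cf y : U y -> {for y, continuous f}.
  by move=> Uy; exact/differentiable_continuous/df.
have LE h : L h = segint m.+1 ('D_h f) x.
  rewrite /L /c /segint.
  have [<- _] := @int01_sum n (fun i => h 0 i)
    (fun i t => t ^+ m.+1 * 'D_(delta_mx 0 i) f (seg x t))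
    (fun i => segint_continuous (m := m.+1) Ux (cDf _)).
  apply: eq_Rintegral => t t01.
  rewrite derive_rVE; last by apply/df/segU; rewrite inE in t01.
  by rewrite mulr_sumr; apply: eq_bigr => i _; rewrite mulrCA.
have linL : linear L.
  move=> b v w; rewrite /L scaler_sumr -big_split/=; apply: eq_bigr => i _.
  by rewrite !mxE mulrDl -mulrA.
pose Ll : {linear V -> R} := HB.pack L (GRing.isLinear.Build R V R *:%R L linL).
have cL : continuous Ll.
  have cL0 : Ck 0 setT L.
    apply: Ck_sum => [|i]; first exact: openT.
    apply: (@CkM _ _ _ _ (fun h : V => h 0 i) (fun=> c i)); first exact: openT.
      by move=> h _; exact: coord_continuous.
    exact: Ck_cst.
  by move=> h; exact: cL0.
suff Hd : (g : V -> R^o) \o shift x =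
    cst (g x : R^o) + (Ll : V -> R^o) +o_ (0 : V) (id : V -> V).
  have dgL : 'd g x = Ll :> (V -> R) by exact: diff_unique.
  have dg : differentiable g x by apply/diff_locallyP; rewrite dgL.
  by split=> // v; rewrite deriveE// dgL -LE.
(* [increment_le] costs a factor [n]; dividing by [n.+1] stays meaningful for [n = 0]. *)
apply/eqaddoP => e e0; pose e' := e / n.+1%:R.
have e'0 : 0 < e' by rewrite divr_gt0.
have ne' : n%:R * e' <= e.
  by rewrite mulrCA ler_piMr ?(ltW e0)// ler_pdivrMr// mul1r ler_nat.
near=> h.
have HU : forall t s : R, 0 <= t <= 1 -> 0 <= s <= 1 -> U (s *: h + seg x t).
  suff: forall t s : R, 0 <= t <= 1 -> 0 <= s <= 1 ->
      U (s *: h + seg x t) /\ `|f (s *: h + seg x t) - f (seg x t)| <= e'.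
    by move=> H t s t01 s01; have [] := H t s t01 s01.
  by near: h; exact: near_seg_unif.
have HD : forall i (t s : R), 0 <= t <= 1 -> 0 <= s <= 1 ->
      U (s *: h + seg x t) /\ `|'D_(delta_mx 0 i) f (s *: h + seg x t)
         - 'D_(delta_mx 0 i) f (seg x t)| <= e'.
  near: h; apply: filter_forall => i.
  apply: (near_seg_unif (f := 'D_(delta_mx 0 i) f)) => //.
  exact: cDf.
(* This is [HU] at [s = t = 1], since [seg x 1] is [x]. *)
have Uhx : U (h + x).
  have := HU 1 1; rewrite scale1r /seg scale1r [a + _]addrC subrK.
  by apply; rewrite lexx ler01.
rewrite !fctE/= LE.
have cA := segint_continuous (m := m) Ux cf.
have cB := segint_continuous (m := m) Uhx cf.
have cC := segint_continuous (m := m.+1) Ux (cDf h).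
(* The integrand of the first-order remainder, with explicit coefficients [-1] to fit
   [int01_lin]. *)
pose rem t := -1 * (t ^+ m * f (seg x t)) +
  (-1 * (t ^+ m.+1 * 'D_h f (seg x t)) + t ^+ m * f (seg (h + x) t)).
have cCB : {in `[0, 1], continuous (fun t : R =>
    -1 * (t ^+ m.+1 * 'D_h f (seg x t)) + t ^+ m * f (seg (h + x) t))}.
  move=> t t01; apply: cvgD; last exact: cB.
  by apply: cvgM; [exact: cvg_cst|exact: cC].
have -> : g (h + x) - (g x + segint m.+1 ('D_h f) x) = int01 rem.
  by rewrite /rem int01_lin// int01_lin// /g /segint !mulN1r; ring.
apply: int01_le.
  move=> t t01; apply: cvgD; last exact: cCB.
  by apply: cvgM; [exact: cvg_cst|exact: cA].
move=> t t01.
(* Moving [x] by [h] moves [seg x t] by [t *: h]: this is where the additional power of [t] in the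
   derivative comes from. *)
have -> : rem t = t ^+ m *
    (f (t *: h + seg x t) - f (seg x t) - t * 'D_h f (seg x t)).
  by rewrite /rem segD exprSr; ring.
have /andP[t0 t1] := t01.
rewrite normrM ger0_norm ?exprn_ge0//.
apply: le_trans (_ : 1 * (n%:R * e' * `|h|) <= _).
  apply: ler_pM => //; [exact: exprn_ge0|exact: exprn_ile1|].
  apply: increment_le => // s s01; split; first exact/df/HU.
  by move=> i; have [] := HD i t s t01 s01.
by rewrite mul1r ler_wpM2r.
Unshelve. all: by end_near. Qed.

Lemma smooth_segint m f : smooth_on U f -> smooth_on U (segint m f).
Proof.
move=> sf k; elim: k m f sf => [|k IH] m f.
  move=> /smooth_onS[df Df] x Ux; apply: differentiable_continuous.
  by have [] := segint_derive m Ux df (fun v => Df v 0%N).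
move=> /smooth_onS[df Df]; have dS x Ux := @segint_derive m f x Ux df
  (fun v => Df v 0%N).
split=> [x Ux|v]; first by have [] := dS x Ux.
apply: (Ck_ext oU _ (IH m.+1 _ (Df v))) => x Ux.
by have [_ ->] := dS x Ux.
Qed.

(** The fundamental theorem of calculus for [f] along the segment from [a] to [x], its derivative
    there being expanded in partial derivatives. *)
Lemma hadamard f x : smooth_on U f -> U x ->
  f x = f a + \sum_i (x - a) 0 i * segint 0 ('D_(delta_mx 0 i) f) x.
Proof.
move=> sf Ux; have /smooth_onS[df Df] := sf.
have cD i := segint_continuous (m := 0) Ux (Df (delta_mx 0 i) 0%N).
have [<- cS] := int01_sum (fun i => (x - a) 0 i) cD.
rewrite (@int01_FTC _ _ (fun t => f (t *: (x - a) + a))).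
- by rewrite scale1r scale0r add0r subrK addrC subrK.
- exact: cS.
- move=> t; rewrite in_itv/= => t01.
  have dft : differentiable f (t *: (x - a) + a).
    by rewrite addrC; exact/df/Useg.
  apply: is_derive_eq; first exact: is_derive_line.
  rewrite derive_rVE//; apply: eq_bigr => i _.
  by rewrite expr0 mul1r /seg [a + _]addrC.
Qed.

End Hadamard.

Lemma open_preimage_on (S T : topologicalType) (A : set S) (W : set T)
  (f : S -> T) : open A -> {within A, continuous f} -> open W ->
  open (A `&` f @^-1` W).
Proof.
move=> oA cf oW; rewrite openE => x [Ax Wx]; apply: filterI.
  exact: open_nbhs_nbhs.
move: cf; rewrite continuous_open_subspace// => cf.
by apply: (cf x (mem_set Ax)); exact: open_nbhs_nbhs.
Qed.

(** * Tangent vectors in a chart *)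

Section charts.
Variables (R : realType) (M : preManifold R).
Implicit Types (c d : chart R M (dimM M)) (p q : M) (f g : M -> R).

Definition ccoord c (i : 'I_(dimM M)) : M -> R := fun x => cmap c x 0 i.

Lemma chart_img_open c (O : set M) : open O ->
  open (cmap c @` (cdom c `&` O)).
Proof.
move=> oO.
have -> : cmap c @` (cdom c `&` O) = (cmap c @` cdom c) `&` cinv c @^-1` O.
  apply/seteqP; split=> [_ [x [cx Ox] <-]|_ [[x cx <-]]] /=.
    by split; [exists x|rewrite cmapK].
  by rewrite cmapK// => Ox; exists x.
by apply: open_preimage_on => //; [exact: cimg_open|exact: cinv_continuous].
Qed.

Lemma chart_preimage_open c (W : set 'rV[R]_(dimM M)) : open W ->
  open (cdom c `&` cmap c @^-1` W).
Proof.
move=> oW; apply: open_preimage_on => //; first exact: cdom_open.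
exact: cmap_continuous.
Qed.

(** [smooth_at] quantifies over all charts at [p]. One suffices, because in any other chart [f] is
    obtained by composing with a smooth transition map. *)
Lemma smooth_at_chart c p f (W : set 'rV[R]_(dimM M)) : atlas c -> cdom c p ->
  open W -> W (cmap c p) -> smooth_on W (f \o cinv c) -> smooth_at p f.
Proof.
move=> ac cp oW Wp sf d ad dp.
pose A := cmap d @` (cdom d `&` cdom c); pose T := cmap c \o cinv d.
have oA : open A by apply: chart_img_open; exact: cdom_open.
have sT : smooth_on A T by exact: atlas_compatible.
have cT : {within A, continuous T}.
  by rewrite continuous_open_subspace// => x /set_mem Ax; exact: (sT 0%N).
exists (A `&` T @^-1` W); split.
- exact: open_preimage_on.
- by split; [exists p|rewrite /T /= cmapK].
- move=> k; have oAW := open_preimage_on oA cT oW.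
  have : Ck k (A `&` T @^-1` W) ((f \o cinv c) \o T).
    apply: (Ck_comp (U' := W)) => //; first by move=> x [].
    by apply: CkW (sT k) => x [].
  apply: Ck_ext => // _ [[x [dx cx] <-] _].
  by rewrite /T /= !cmapK.
Qed.

Lemma smooth_at_ext p f g (O : set M) : open O -> O p ->
  (forall x, O x -> f x = g x) -> smooth_at p f -> smooth_at p g.
Proof.
move=> oO Op fg sf c ac cp; have [W [oW Wp sW]] := sf c ac cp.
have oI := openI oW (chart_img_open (c := c) oO).
exists (W `&` cmap c @` (cdom c `&` O)); split=> //.
  by split=> //; exists p.
move=> k; have : Ck k (W `&` cmap c @` (cdom c `&` O)) (f \o cinv c).
  by apply: CkW (sW k) => x [].
apply: Ck_ext => // _ [_ [x [cx Ox] <-]].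
by rewrite /= cmapK// fg.
Qed.

Lemma smooth_at_open p f : smooth_at p f ->
  exists O : set M, [/\ open O, O p & forall q, O q -> smooth_at q f].
Proof.
move=> sf; have [c ac cp] := atlas_cover p.
have [W [oW Wp sW]] := sf c ac cp.
exists (cdom c `&` cmap c @^-1` W); split=> //.
  exact: chart_preimage_open.
by move=> q [cq Wq]; exact: (smooth_at_chart ac cq oW).
Qed.

Lemma smooth_at_ccomp c p (g : 'rV[R]_(dimM M) -> R)
  (W : set 'rV[R]_(dimM M)) : atlas c -> cdom c p -> open W -> W (cmap c p) ->
  smooth_on W g -> smooth_at p (g \o cmap c).
Proof.
move=> ac cp oW Wp sg.
have oI := openI oW (@cimg_open _ _ _ c).
apply: (smooth_at_chart ac cp oI); first by split=> //; exists p.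
move=> k; have : Ck k (W `&` cmap c @` cdom c) g.
  by apply: CkW (sg k) => x [].
apply: Ck_ext => // _ [_ [x cx <-]].
by rewrite /= cmapK.
Qed.

Lemma smooth_ccoord c p i : atlas c -> cdom c p -> smooth_at p (ccoord c i).
Proof.
move=> ac cp; apply: (smooth_at_chart ac cp (@cimg_open _ _ _ c)).
  by exists p.
move=> k; apply: (@Ck_coord _ _ _ _ _ (cmap c \o cinv c)).
  exact: cimg_open.
by apply: CkW (atlas_compatible ac ac k) => _ [x cx <-]; exists x.
Qed.

Lemma smooth_at_cst p (a : R) : smooth_at p (fun=> a).
Proof.
by move=> c ac cp; exists setT; split=> [||k]; [exact: openT| |exact: Ck_cst].
Qed.

Lemma smooth_at_sum p n (f : 'I_n -> M -> R) : (forall i, smooth_at p (f i)) ->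
  smooth_at p (fun x => \sum_i f i x).
Proof.
elim: n f => [|n IH] f sf.
  by under eq_fun do rewrite big_ord0; exact: smooth_at_cst.
under eq_fun do rewrite big_ord_recl.
by apply: smooth_atD; [exact: sf|exact: IH].
Qed.

Lemma smooth_atB p f g : smooth_at p f -> smooth_at p g ->
  smooth_at p (fun x => f x - g x).
Proof. by move=> sf sg; apply: smooth_atD => //; exact: smooth_atN. Qed.

Lemma tangent_cst p (v : tvec M) (a : R) : tangent p v -> v (fun=> a) = 0.
Proof.
move=> [_ vl vM]; have s1 := @smooth_at_cst p 1; have s0 := @smooth_at_cst p 0.
(* Leibniz's rule for [1 * 1] gives [v 1 = v 1 + v 1]. *)
have v1 : v (fun=> 1) = 0.
  have := vM _ _ s1 s1; rewrite !mulr1 mul1r.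
  by move=> /(congr1 (fun z => z - v (fun=> 1))); rewrite subrr addrK => <-.
(* The constant [a] is written [(a - 1) * 1 + 1] to fit the linearity clause of [tangent]. *)
by have := vl (a - 1) _ _ s1 s1; rewrite v1 mulr1 subrK mulr0 addr0.
Qed.

(* Leibniz's rule applied to the indicator function of [O], which is constant
   near [p], shows that [v] only sees germs. *)
Lemma tangent_ext p (v : tvec M) f g (O : set M) : tangent p v -> open O ->
  O p -> (forall x, O x -> f x = g x) -> smooth_at p f -> v f = v g.
Proof.
move=> tv oO Op fg sf; have sg := smooth_at_ext oO Op fg sf.
pose chi x : R := if `[< O x >] then 1 else 0.
have chi1 x : O x -> chi x = 1 by move=> Ox; rewrite /chi asboolT.
have schi : smooth_at p chi.
  apply: (smooth_at_ext oO Op _ (@smooth_at_cst p 1)) => x Ox.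
  by rewrite chi1.
have [_ _ vM] := tv.
have vchi : v chi = 0.
  have := vM _ _ schi schi; rewrite chi1// mulr1 mul1r.
  have -> : (fun x => chi x * chi x) = chi.
    by apply/funext => x; rewrite /chi; case: asboolP; rewrite ?mulr1 ?mulr0.
  by move=> /(congr1 (fun z => z - v chi)); rewrite subrr addrK => <-.
have E h : smooth_at p h -> v h = v (fun x => h x * chi x).
  by move=> sh; rewrite vM// vchi mulr0 addr0 chi1// mulr1.
rewrite E// (E g)//; congr v; apply/funext => x; rewrite /chi.
by case: asboolP => [/fg->//|_]; rewrite !mulr0.
Qed.

Lemma tangentN p (v : tvec M) f : tangent p v -> smooth_at p f ->
  v (fun x => - f x) = - v f.
Proof.
move=> tv sf; have [_ vl _] := tv.
have := vl (-1) _ _ sf (@smooth_at_cst p 0).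
under eq_fun do rewrite mulN1r addr0.
by rewrite (tangent_cst 0 tv) addr0 mulN1r.
Qed.

Lemma tangentB p (v : tvec M) f g : tangent p v -> smooth_at p f ->
  smooth_at p g -> v (fun x => f x - g x) = v f - v g.
Proof.
by move=> tv sf sg; rewrite (tangentD tv)// ?(tangentN tv)//; exact: smooth_atN.
Qed.

Lemma tangent_sumf p (v : tvec M) n (f : 'I_n -> M -> R) : tangent p v ->
  (forall i, smooth_at p (f i)) ->
  v (fun x => \sum_i f i x) = \sum_i v (f i).
Proof.
move=> tv; elim: n f => [|n IH] f sf.
  by under eq_fun do rewrite big_ord0; rewrite big_ord0 (tangent_cst _ tv).
under eq_fun do rewrite big_ord_recl.
rewrite (tangentD tv)//; last exact: smooth_at_sum.
by rewrite big_ord_recl IH.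
Qed.

(** The guard gives the value 0 on functions not smooth at [q], the normalisation demanded by
    [tangent]. *)
Definition cpartial c (i : 'I_(dimM M)) (q : M) : tvec M := fun f =>
  if `[< smooth_at q f >] then
    'D_(delta_mx 0 i) (f \o cinv c) (cmap c q) else 0.

Lemma smooth_at_derivable c p f v : atlas c -> cdom c p -> smooth_at p f ->
  derivable (f \o cinv c) (cmap c p) v.
Proof.
move=> ac cp sf; have [W [oW Wp sW]] := sf c ac cp.
by apply: diff_derivable; exact: (sW 1%N).1.
Qed.

Lemma tangent_cpartial c i q : atlas c -> cdom c q ->
  tangent q (cpartial c i q).
Proof.
move=> ac cq; have dc f (sf : smooth_at q f) :=
  @smooth_at_derivable c q f (delta_mx 0 i) ac cq sf.
split=> [f nf|a f g sf sg|f g sf sg]; rewrite /cpartial.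
- by rewrite asboolF.
- rewrite !asboolT//; last exact: smooth_at_lin.
  have -> : (fun x => a * f x + g x) \o cinv c =
    a *: (f \o cinv c) + (g \o cinv c) by [].
  rewrite deriveD; [|exact/derivableZ/dc|exact: dc].
  by rewrite deriveZ//; exact: dc.
- rewrite !asboolT//; last exact: smooth_atM.
  have -> : (fun x => f x * g x) \o cinv c =
    (f \o cinv c) * (g \o cinv c) by [].
  rewrite deriveM; [|exact: dc|exact: dc].
  by rewrite [LHS]addrC; congr (_ + _); rewrite -[LHS]/(_ * _) /= cmapK// mulrC.
Qed.

Lemma vfield_cpartial c i : atlas c -> vfield_on (cdom c) (cpartial c i).
Proof.
move=> ac q cq; split=> [|f sf]; first exact: tangent_cpartial.
(* Smoothness at a point is an open condition, so the guard in [cpartial] holds throughout a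
   neighbourhood of [q]. *)
have [Q [oQ Qq sQ]] := smooth_at_open sf.
have [W [oW Wq sW]] := sf c ac cq.
have oI := openI oQ (@cdom_open _ _ _ c).
have sD : smooth_at q ((fun x => 'D_(delta_mx 0 i) (f \o cinv c) x) \o cmap c).
  by apply: (smooth_at_ccomp ac cq oW Wq) => k; exact: (sW k.+1).2.
apply: (smooth_at_ext oI _ _ sD) => // x [Qx cx] /=.
by rewrite /cpartial asboolT//; exact: sQ.
Qed.

Lemma cpartial_ccoord c i j q : atlas c -> cdom c q ->
  cpartial c i q (ccoord c j) = (i == j)%:R.
Proof.
move=> ac cq; rewrite /cpartial asboolT; last exact: smooth_ccoord.
have E : 'D_(delta_mx 0 i) (fun x : 'rV[R]_(dimM M) => x 0 j) (cmap c q) =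
    (i == j)%:R.
  have := @derive_mx R _ _ _ id (cmap c q) (delta_mx 0 i) (@derivable_id _ _ _ _).
  rewrite derive_id => /(congr1 (fun A : 'rV[R]_(dimM M) => A 0 j)).
  by rewrite !mxE eqxx/= eq_sym => <-.
rewrite -E; apply: near_eq_derive; near=> x.
have : (cmap c @` cdom c) x.
  near: x; apply: open_nbhs_nbhs; split; first exact: cimg_open.
  by exists q.
by move=> [y cy <-]; rewrite /ccoord /= cmapK.
Unshelve. all: by end_near. Qed.

(** Hadamard's lemma writes [f] near [p] as a constant plus products of [ccoord c i - a 0 i] with
    smooth functions [G i], whose values at [p] are the partial derivatives of [f]; then [v] is
    applied term by term. *)
Lemma tangent_span c p (v : tvec M) : atlas c -> cdom c p -> tangent p v ->
  v = \sum_i v (ccoord c i) *: cpartial c i p.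
Proof.
move=> ac cp tv; apply/funext => f.
have -> : (\sum_i v (ccoord c i) *: cpartial c i p) f =
    \sum_i v (ccoord c i) * cpartial c i p f.
  by elim/big_rec2 : _ => // i y z _ <-.
have [sf|nf] := pselect (smooth_at p f); last first.
  have [v0 _ _] := tv; rewrite v0// big1// => i _.
  by rewrite /cpartial asboolF// mulr0.
have [W [oW Wp sW]] := sf c ac cp.
pose a := cmap c p; pose F := f \o cinv c.
have [r /= r0 rW] : nbhs_ball a W.
  by apply/nbhs_ballP; exact: open_nbhs_nbhs.
(* A ball contains the segments from its centre, as [hadamard] requires. *)
pose U := ball a r.
have oU : open U by exact: ball_open.
have Ua : U a by exact: ballxx.
have Useg x (t : R) : U x -> 0 <= t <= 1 -> U (seg a x t).
  rewrite /U -ball_normE/= => xr /andP[t0 t1].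
  rewrite /seg opprD addrA subrr sub0r normrN normrZ ger0_norm//.
  by rewrite distrC; apply: le_lt_trans xr; rewrite ler_piMl.
have sF : smooth_on U F by move=> k; apply: CkW (sW k).
pose G i := segint a 0 ('D_(delta_mx 0 i) F).
have sG i : smooth_on U (G i).
  apply: smooth_segint => //.
  by have /smooth_onS[_ ] := sF; exact.
have oO := chart_preimage_open c oU.
have sx i : smooth_at p (ccoord c i) by exact: smooth_ccoord.
have sGc i : smooth_at p (G i \o cmap c) by exact: smooth_at_ccomp (sG i).
have sxa i : smooth_at p (fun x => ccoord c i x - a 0 i).
  by apply: smooth_atB; [exact: sx|exact: smooth_at_cst].
pose h i x := (ccoord c i x - a 0 i) * (G i \o cmap c) x.
have sh i : smooth_at p (h i) by exact: smooth_atM.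
rewrite (tangent_ext (g := fun x => f p + \sum_i h i x) tv oO)//; last first.
  move=> x [cx Ux]; have := hadamard Useg sF Ux.
  rewrite /F /= !cmapK// => ->; congr (_ + _); apply: eq_bigr => i _.
  by rewrite /h /ccoord !mxE.
rewrite (tangentD tv); [|exact: smooth_at_cst|exact: smooth_at_sum].
rewrite (tangent_cst _ tv) add0r (tangent_sumf tv)//; apply: eq_bigr => i _.
(* The factor [ccoord c i - a 0 i] vanishes at [p], so only the term of Leibniz's rule that
   differentiates it survives. *)
have [_ _ vM] := tv; rewrite vM// subrr mul0r addr0.
rewrite (tangentB tv)//; last exact: smooth_at_cst.
rewrite (tangent_cst _ tv) subr0; congr (_ * _).
rewrite /cpartial asboolT// /G /segint /= -/a.
(* At the centre the segment is constant, so the average is the partial derivative itself. *)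
have -> : (fun t : R => t ^+ 0 * 'D_(delta_mx 0 i) F (seg a a t)) =
    cst ('D_(delta_mx 0 i) F a).
  by apply/funext => t; rewrite expr0 mul1r /seg subrr scaler0 addr0.
rewrite /int01 Rintegral_cst//= lebesgue_measure_itv/= lte_fin ltr01.
by rewrite oppr0 adde0 mulr1.
Qed.

End charts.

(** * Pullback of closed 2-forms *)

Section closedAlgebra.
Variables (R : realType) (n : nat) (b : 'I_n -> 'I_n -> R).
Variable d : 'I_n -> 'I_n -> 'I_n -> R.
Implicit Types u v w x y z : 'I_n -> R.

Definition bil u v : R := \sum_i \sum_j u i * v j * b i j.
(** With [d k i j] the derivative of the coefficient [b i j] along the [k]-th coordinate, this is
    the part of X(B(Y, Z)) that differentiates the coefficients of B. *)
Definition tril x y z : R := \sum_k \sum_i \sum_j x k * y i * z j * d k i j.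

Hypothesis banti : forall i j, b i j = - b j i.
Hypothesis dclosed : forall k i j, d k i j - d i k j + d j k i = 0.

Lemma bil_anti u v : bil u v = - bil v u.
Proof.
rewrite /bil exchange_big -sumrN; apply: eq_bigr => i _; rewrite -sumrN.
by apply: eq_bigr => j _; rewrite banti; ring.
Qed.

Lemma bilBl u v w : bil (fun i => u i - v i) w = bil u w - bil v w.
Proof.
rewrite /bil -sumrB; apply: eq_bigr => i _; rewrite -sumrB.
by apply: eq_bigr => j _; ring.
Qed.

Lemma tril_closed x y z : tril x y z - tril y x z + tril z x y = 0.
Proof.
(* Relabelling gives all three sums the common monomial [x k * y i * z j], so that [dclosed] applies
   term by term. *)
have -> : tril y x z = \sum_k \sum_i \sum_j x k * y i * z j * d i k j.
  rewrite /tril exchange_big; apply: eq_bigr => k _; apply: eq_bigr => i _.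
  by apply: eq_bigr => j _; ring.
have -> : tril z x y = \sum_k \sum_i \sum_j x k * y i * z j * d j k i.
  rewrite /tril exchange_big; apply: eq_bigr => k _; rewrite exchange_big.
  by apply: eq_bigr => i _; apply: eq_bigr => j _; ring.
rewrite /tril -sumrB -big_split/= big1// => k _.
rewrite -sumrB -big_split/= big1// => i _.
rewrite -sumrB -big_split/= big1// => j _.
transitivity (x k * y i * z j * (d k i j - d i k j + d j k i)); first by ring.
by rewrite dclosed mulr0.
Qed.

End closedAlgebra.

Section pullback.
Variables (R : realType) (N M : preManifold R) (F : N -> M).
Variable B : M -> tvec M -> covec M.

(* The guard is needed because [dmap F n v] may be tangent when [v] is not. *)
Definition pullback2 (n : N) (v : tvec N) : covec N :=
  if `[< tangent n v >] then comap F n (B (F n) (dmap F n v)) else 0.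

Lemma pullback2E n v w : tangent n v -> tangent n w ->
  pullback2 n v w = B (F n) (dmap F n v) (dmap F n w).
Proof. by move=> tv tw; rewrite /pullback2 asboolT// /comap asboolT. Qed.

End pullback.

Lemma cotangent0 (R : realType) (M : preManifold R) (p : M) :
  cotangent p (0 : covec M).
Proof.
have E v : (0 : covec M) v = 0 by [].
by split=> [v _|a v w _ _]; rewrite !E ?mulr0 ?addr0.
Qed.

Lemma cotangent_zero (R : realType) (M : preManifold R) (p : M) (b : covec M) :
  cotangent p b -> b 0 = 0.
Proof.
move=> [_ bl]; have := bl 1 _ _ (tangent0 p) (tangent0 p).
rewrite scale1r addr0 mul1r => /(congr1 (fun x => x - b 0)).
by rewrite subrr addrK.
Qed.

(** The obstruction to Leibniz's rule for [X \o Y] is [X p f * Y p g + Y p f * X p g], which is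
    symmetric in the two fields and cancels in the commutator. *)
Lemma tangent_lie (R : realType) (M : preManifold R) (V : set M)
  (X Y : M -> tvec M) (p : M) : open V -> V p -> vfield_on V X ->
  vfield_on V Y -> tangent p (lie X Y p).
Proof.
move=> oV Vp HX HY; have [[tX sX] [tY sY]] := (HX p Vp, HY p Vp).
(* The rules for a field at a nearby point [q] require [q] in [V] and both functions smooth at [q];
   [tangent_ext] then localises to the set [Q] of such points. *)
have near2 (f g : M -> R) : smooth_at p f -> smooth_at p g ->
    exists Q : set M, [/\ open Q, Q p &
      forall q, Q q -> [/\ V q, smooth_at q f & smooth_at q g]].
  move=> sf sg; have [Qf [oQf Qfp Hf]] := smooth_at_open sf.
  have [Qg [oQg Qgp Hg]] := smooth_at_open sg.
  exists (V `&` (Qf `&` Qg)); split=> //; first exact: openI oV (openI oQf oQg).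
  by move=> q [Vq [Qfq Qgq]]; split=> //; [exact: Hf|exact: Hg].
split=> [f nf|a f g sf sg|f g sf sg]; rewrite /lie.
- by rewrite asboolF.
- rewrite !asboolT//; last exact: smooth_at_lin.
  have [Q [oQ Qp HQ]] := near2 f g sf sg.
  have E (Z W : M -> tvec M) : vfield_on V Z -> vfield_on V W ->
      Z p (fun y => W y (fun x => a * f x + g x)) =
      a * Z p (fun y => W y f) + Z p (fun y => W y g).
    move=> HZ HW; have [[tZ _] [_ sW]] := (HZ p Vp, HW p Vp).
    have [_ Zl _] := tZ; rewrite -Zl; [|exact: sW|exact: sW].
    symmetry; apply: (tangent_ext tZ oQ Qp).
      by move=> q /HQ[/HW[[_ Wl _] _] sfq sgq]; rewrite Wl.
    by apply: smooth_at_lin; exact: sW.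
  by rewrite !E//; ring.
- rewrite !asboolT//; last exact: smooth_atM.
  have [Q [oQ Qp HQ]] := near2 f g sf sg.
  have E (Z W : M -> tvec M) : vfield_on V Z -> vfield_on V W ->
      Z p (fun y => W y (fun x => f x * g x)) =
      (Z p (fun y => W y f) * g p + W p f * Z p g) +
      (Z p f * W p g + f p * Z p (fun y => W y g)).
    move=> HZ HW; have [[tZ _] [_ sW]] := (HZ p Vp, HW p Vp).
    have [_ _ ZM] := tZ.
    rewrite -!ZM//; [|exact: sW|exact: sW].
    rewrite -(tangentD tZ); [|apply: smooth_atM => //; exact: sW..].
    symmetry; apply: (tangent_ext tZ oQ Qp).
      by move=> q /HQ[/HW[[_ _ WM] _] sfq sgq]; rewrite WM.
    by apply: smooth_atD; apply: smooth_atM => //; exact: sW.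
  by rewrite !E//; ring.
Qed.

(** * Closed 2-forms in the coordinates of a chart *)

Section twoForm.
Variables (R : realType) (M : preManifold R) (B : M -> tvec M -> covec M).

(** Polarisation of [B x u u = 0] at [u = v + w]; if an argument is not tangent, both sides are 0 by
    normalisation. *)
Lemma two_form_anti x v w : two_form B -> B x v w = - B x w v.
Proof.
move=> [Bc Bc' alt _].
have [tv|ntv] := pselect (tangent x v); last first.
  by rewrite (Bc x w).1// (Bc' x w).1// oppr0.
have [tw|ntw] := pselect (tangent x w); last first.
  by rewrite (Bc x v).1// (Bc' x v).1// oppr0.
have := alt x (1 *: v + w); rewrite (Bc x _).2// (Bc' x v).2// (Bc' x w).2//.
by rewrite !alt !mul1r addr0 add0r addrC => /eqP; rewrite addr_eq0 => /eqP.
Qed.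

Lemma two_form_sum x n (e : 'I_n -> tvec M) (v w : 'I_n -> R) : two_form B ->
  (forall i, tangent x (e i)) ->
  B x (\sum_i v i *: e i) (\sum_j w j *: e j) =
  bil (fun i j => B x (e i) (e j)) v w.
Proof.
move=> [Bc Bc' _ _] te.
rewrite (cotangent_sum v (Bc' x _) te).2; apply: eq_bigr => i _.
rewrite (cotangent_sum w (Bc x _) te).2 mulr_sumr.
by apply: eq_bigr => j _; rewrite mulrA.
Qed.

(* The bracket is a derivation killing the coordinates, so it vanishes by
   [tangent_span]; no symmetry of second derivatives is needed. *)
Lemma lie_cpartial c i j q : atlas c -> cdom c q ->
  lie (cpartial (M := M) c i) (cpartial c j) q = 0.
Proof.
move=> ac cq; have V i' := @vfield_cpartial R M c i' ac.
have oc := @cdom_open _ _ _ c.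
rewrite (tangent_span ac cq (tangent_lie oc cq (V i) (V j))).
rewrite big1// => k _; rewrite /lie asboolT; last exact: smooth_ccoord.
have E i' j' : cpartial c i' q (fun y => cpartial c j' y (ccoord c k)) = 0.
  have tc := tangent_cpartial i' ac cq.
  rewrite -(tangent_ext (f := fun=> (j' == k)%:R) tc oc cq).
  - exact: tangent_cst tc.
  - by move=> y cy; rewrite cpartial_ccoord.
  - exact: smooth_at_cst.
by rewrite !E subrr scale0r.
Qed.

Definition ccoef c (i j : 'I_(dimM M)) (q : M) : R :=
  B q (cpartial c i q) (cpartial c j q).

Lemma smooth_ccoef c i j q : two_form B -> atlas c -> cdom c q ->
  smooth_at q (ccoef c i j).
Proof.
move=> [_ _ _ sB] ac cq; apply: (sB (cdom c)) => //; first exact: cdom_open.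
all: exact: vfield_cpartial.
Qed.

(** The formula for dB on coordinate fields, whose bracket terms vanish by [lie_cpartial]. *)
Lemma closed_ccoef c k i j q : closed_two_form B -> atlas c -> cdom c q ->
  cpartial c k q (ccoef c i j) - cpartial c i q (ccoef c k j)
  + cpartial c j q (ccoef c k i) = 0.
Proof.
move=> [[Bc Bc' _ _] clB] ac cq; have V i' := @vfield_cpartial R M c i' ac.
have B0 w : B q 0 w = 0 by exact: (cotangent_zero (Bc' q w)).
have := clB _ _ _ _ (@cdom_open _ _ _ c) (V k) (V i) (V j) q cq.
rewrite /ext_deriv2 !lie_cpartial// !B0.
by rewrite subr0 addr0 subr0.
Qed.

End twoForm.

(** * Smoothness and closedness of the pullback *)

Section pullbackClosed.
Variables (R : realType) (N M : preManifold R) (F : N -> M).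
Hypothesis sF : smooth_map F.
Variables (B : M -> tvec M -> covec M) (clB : closed_two_form B).

Let BB : two_form B := clB.1.

Lemma dmap_ccoord (c : chart R M (dimM M)) i n (v : tvec N) :
  atlas c -> cdom c (F n) -> dmap F n v (ccoord c i) = v (ccoord c i \o F).
Proof. by move=> ac cn; rewrite /dmap asboolT//; exact: smooth_ccoord. Qed.

(** By [tangent_span] the components of [dmap F n v] are the values of [v] on [ccoord c i \o F], so
    that the right-hand side varies through functions on N alone. *)
Lemma pullback2_bil (c : chart R M (dimM M)) n (v w : tvec N) :
  atlas c -> cdom c (F n) -> tangent n v -> tangent n w ->
  pullback2 F B n v w = bil (fun i j => ccoef B c i j (F n))
    (fun i => v (ccoord c i \o F)) (fun i => w (ccoord c i \o F)).
Proof.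
move=> ac cn tv tw; rewrite pullback2E//.
rewrite (tangent_span ac cn (tangent_dmap sF tv)).
rewrite (tangent_span ac cn (tangent_dmap sF tw)).
rewrite two_form_sum//; last by move=> i; exact: tangent_cpartial.
rewrite /bil; apply: eq_bigr => i _; apply: eq_bigr => j _.
by rewrite !dmap_ccoord.
Qed.

Lemma pullback2_cotangent n v : cotangent n (pullback2 F B n v).
Proof.
rewrite /pullback2; case: asboolP => _; last exact: cotangent0.
by apply: cotangent_comap => //; case: BB.
Qed.

Lemma pullback2_cotangentl n w :
  cotangent n ((fun v => pullback2 F B n v w) : covec N).
Proof.
split=> [v nv|a v v' tv tv']; first by rewrite /pullback2 asboolF.
have [tw|ntw] := pselect (tangent n w); last first.
  have Z u : pullback2 F B n u w = 0 by rewrite (pullback2_cotangent n u).1.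
  by rewrite !Z mulr0 addr0.
rewrite !pullback2E//; last exact: tangent_lin.
rewrite dmap_lin; have [_ Bc' _ _] := BB.
by rewrite (Bc' (F n) _).2//; exact: tangent_dmap.
Qed.

Lemma smooth_bil (b : 'I_(dimM M) -> 'I_(dimM M) -> N -> R)
  (x y : 'I_(dimM M) -> N -> R) n : (forall i j, smooth_at n (b i j)) ->
  (forall i, smooth_at n (x i)) -> (forall i, smooth_at n (y i)) ->
  smooth_at n (fun q => bil (fun i j => b i j q) (x^~ q) (y^~ q)).
Proof.
move=> sb sx sy; apply: smooth_at_sum => i; apply: smooth_at_sum => j.
apply: smooth_atM; last exact: sb.
by apply: smooth_atM; [exact: sx|exact: sy].
Qed.

Section nearPoint.
Variables (p : N) (c : chart R M (dimM M)) (V : set N).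
Hypotheses (ac : atlas c) (cp : cdom c (F p)) (oV : open V) (Vp : V p).

Let Q : set N := V `&` F @^-1` cdom c.

Let oQ : open Q.
Proof.
apply: openI => //; apply: open_comp; last exact: cdom_open.
by move=> x _; exact: sF.1.
Qed.

Let sb i j : smooth_at p (ccoef B c i j \o F).
Proof. by apply: sF.2; exact: smooth_ccoef. Qed.

Let sx i : smooth_at p (ccoord c i \o F).
Proof. by apply: sF.2; exact: smooth_ccoord. Qed.

Let comp (X : N -> tvec N) i (q : N) : R := X q (ccoord c i \o F).

Let scomp X i : vfield_on V X -> smooth_at p (comp X i).
Proof. by move=> HX; have [_] := HX p Vp; apply; exact: sx. Qed.

Let localE X Y : vfield_on V X -> vfield_on V Y -> forall q, Q q ->
  bil (fun i j => ccoef B c i j (F q)) (comp X ^~ q) (comp Y ^~ q) =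
  pullback2 F B q (X q) (Y q).
Proof.
move=> HX HY q [Vq cq]; rewrite (pullback2_bil ac cq)//.
- by have [] := HX q Vq.
- by have [] := HY q Vq.
Qed.

Let slocal X Y : vfield_on V X -> vfield_on V Y ->
  smooth_at p (fun q => bil (fun i j => ccoef B c i j (F q))
    (comp X ^~ q) (comp Y ^~ q)).
Proof.
move=> HX HY; apply: (smooth_bil (b := fun i j => ccoef B c i j \o F)) => [|i|i].
- exact: sb.
- exact: scomp.
- exact: scomp.
Qed.

Lemma pullback2_smooth X Y : vfield_on V X -> vfield_on V Y ->
  smooth_at p (fun q => pullback2 F B q (X q) (Y q)).
Proof.
move=> HX HY; apply: (smooth_at_ext oQ _ (localE HX HY)) => //.
exact: slocal.
Qed.

Let b i j := ccoef B c i j (F p).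
Let d k i j := cpartial c k (F p) (ccoef B c i j).

(** The product rule on the local expression. The [tril] term collects the derivatives of the
    coefficients, the two [bil] terms those of the components of [Y] and [Z]. *)
Lemma pullback2_deriv X Y Z : vfield_on V X -> vfield_on V Y -> vfield_on V Z ->
  X p (fun q => pullback2 F B q (Y q) (Z q)) =
  tril d (comp X ^~ p) (comp Y ^~ p) (comp Z ^~ p)
  + bil b (fun i => X p (comp Y i)) (comp Z ^~ p)
  + bil b (comp Y ^~ p) (fun i => X p (comp Z i)).
Proof.
move=> HX HY HZ; have [tX _] := HX p Vp; have [_ _ XM] := tX.
have Qp : Q p by [].
rewrite -(tangent_ext tX oQ Qp (localE HY HZ) (slocal HY HZ)).
have sYZ i j : smooth_at p (fun q => comp Y i q * comp Z j q).
  by apply: smooth_atM; exact: scomp.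
have sj i j : smooth_at p
    (fun q => comp Y i q * comp Z j q * ccoef B c i j (F q)).
  by apply: smooth_atM; [exact: sYZ|exact: sb].
(* The chain rule: [tangent_span] is applied to the image of [X p] under the differential of [F]. *)
have Xb i j : X p (ccoef B c i j \o F) = \sum_k comp X k p * d k i j.
  have sbM : smooth_at (F p) (ccoef B c i j) by exact: smooth_ccoef.
  have := tangent_span ac cp (tangent_dmap sF tX).
  move=> /(congr1 (fun v : tvec M => v (ccoef B c i j))).
  rewrite {1}/dmap asboolT// => ->.
  have -> : forall (e : 'I_(dimM M) -> tvec M) f,
      (\sum_k e k) f = \sum_k e k f.
    by move=> e f; elim/big_rec2 : _ => // k y z _ <-.
  by apply: eq_bigr => k _; rewrite /comp -(dmap_ccoord _ _ ac cp).
rewrite /bil (tangent_sumf tX); last by move=> i; exact: smooth_at_sum.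
have -> : tril d (comp X ^~ p) (comp Y ^~ p) (comp Z ^~ p) =
    \sum_i \sum_j comp Y i p * comp Z j p * X p (ccoef B c i j \o F).
  rewrite /tril exchange_big; apply: eq_bigr => i _.
  rewrite exchange_big; apply: eq_bigr => j _.
  by rewrite Xb mulr_sumr; apply: eq_bigr => k _; ring.
rewrite -!big_split/=; apply: eq_bigr => i _.
rewrite (tangent_sumf tX)// -!big_split/=; apply: eq_bigr => j _.
rewrite (XM (fun q => comp Y i q * comp Z j q) (ccoef B c i j \o F))//.
rewrite (XM (comp Y i) (comp Z j)); [|exact: scomp|exact: scomp].
by rewrite /b /=; ring.
Qed.

Lemma pullback2_lie X Y Z : vfield_on V X -> vfield_on V Y -> vfield_on V Z ->
  pullback2 F B p (lie X Y p) (Z p) =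
  bil b (fun i => X p (comp Y i)) (comp Z ^~ p)
  - bil b (fun i => Y p (comp X i)) (comp Z ^~ p).
Proof.
move=> HX HY HZ; rewrite (pullback2_bil ac cp).
- rewrite -bilBl; congr bil; apply/funext => i.
  by rewrite /lie asboolT//; exact: sx.
- exact: tangent_lie HX HY.
- by have [] := HZ p Vp.
Qed.

Lemma pullback2_ext_deriv X Y Z :
  vfield_on V X -> vfield_on V Y -> vfield_on V Z ->
  ext_deriv2 (pullback2 F B) X Y Z p = 0.
Proof.
move=> HX HY HZ; rewrite /ext_deriv2 !pullback2_deriv// !pullback2_lie//.
have banti i j : b i j = - b j i by exact: two_form_anti.
have dcl k i j : d k i j - d i k j + d j k i = 0 by exact: closed_ccoef.
have A := bil_anti banti.
have T := tril_closed dcl (comp X ^~ p) (comp Y ^~ p) (comp Z ^~ p).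
rewrite -[RHS]T.
(* Antisymmetry moves the differentiated components to the first slot, where they cancel against the
   bracket terms; the three [tril] terms add up to 0 by [T]. *)
rewrite (A (comp Y ^~ p) (fun i => X p (comp Z i))).
rewrite (A (comp X ^~ p) (fun i => Y p (comp Z i))).
rewrite (A (comp X ^~ p) (fun i => Z p (comp Y i))).
ring.
Qed.

End nearPoint.

Lemma closed_pullback2 : closed_two_form (pullback2 F B).
Proof.
split; first split.
- exact: pullback2_cotangent.
- exact: pullback2_cotangentl.
- move=> n v; have [tv|nv] := pselect (tangent n v).
    by rewrite pullback2E//; case: BB.
  by rewrite /pullback2 asboolF.
- move=> V X Y oV HX HY p Vp; have [c ac cp] := atlas_cover (F p).
  exact: (pullback2_smooth ac cp oV Vp).
- move=> V X Y Z oV HX HY HZ p Vp; have [c ac cp] := atlas_cover (F p).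
  exact: (pullback2_ext_deriv ac cp oV Vp).
Qed.

End pullbackClosed.

(** * Gauge transformations *)

Section gaugeTransform.
Variables (R : realType) (M : preManifold R) (B : M -> tvec M -> covec M).

Lemma gauge_fibP (D : M -> set (gtvec M)) x s :
  gauge_fib D B x s <-> D x (s.1, s.2 - B x s.1).
Proof.
split=> [[t Dt <-] /=|Ds]; first by rewrite addrK; case: t Dt.
by exists (s.1, s.2 - B x s.1) => //=; rewrite subrK; case: s Ds.
Qed.

Lemma closed_two_formN : closed_two_form B ->
  closed_two_form (fun x v => - B x v).
Proof.
move=> [[Bc Bc' alt sB] clB].
have E x v w : (- B x v) w = - B x v w by [].
split; first split.
- by move=> x v; exact/cotangentN/Bc.
- by move=> x w; exact: cotangentN (Bc' x w).
- by move=> x v; rewrite E alt oppr0.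
- by move=> V X Y oV HX HY x Vx; exact/smooth_atN/(sB V).
move=> V X Y Z oV HX HY HZ p Vp.
have sBV X' Y' : vfield_on V X' -> vfield_on V Y' ->
    smooth_at p (fun q => B q (X' q) (Y' q)).
  by move=> HX' HY'; exact: sB HX' HY' p Vp.
have N X' Y' Z' : vfield_on V X' -> vfield_on V Y' -> vfield_on V Z' ->
    X' p (fun q => (- B q (Y' q)) (Z' q)) = - X' p (fun q => B q (Y' q) (Z' q)).
  by move=> HX' HY' HZ'; apply: tangentN; [exact: (HX' p Vp).1|exact: sBV].
have := clB V X Y Z oV HX HY HZ p Vp; rewrite /ext_deriv2 !N// !E => dB0.
by rewrite -[RHS]oppr0 -[in RHS]dB0; ring.
Qed.

End gaugeTransform.

Lemma two_form0 (R : realType) (M : preManifold R) (B : M -> tvec M -> covec M)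
  x : two_form B -> B x 0 = 0.
Proof.
by move=> [_ Bc' _ _]; apply/funext => w; exact: (cotangent_zero (Bc' x w)).
Qed.

Section pullbackGauge.
Variables (R : realType) (N M : preManifold R) (F : N -> M).

Lemma comapD n b b' : comap F n (b + b') = comap F n b + comap F n b'.
Proof.
apply/funext => v; rewrite -[RHS]/(comap F n b v + comap F n b' v) /comap.
by case: asboolP => // _; rewrite addr0.
Qed.

Lemma comapN n b : comap F n (- b) = - comap F n b.
Proof.
apply/funext => v; rewrite -[RHS]/(- comap F n b v) /comap.
by case: asboolP => // _; rewrite oppr0.
Qed.

Lemma comap0 n : comap F n 0 = 0.
Proof. by apply/funext => v; rewrite /comap if_same. Qed.

Variable B : M -> tvec M -> covec M.

Lemma pullback2_comap n v : tangent n v ->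
  pullback2 F B n v = comap F n (B (F n) (dmap F n v)).
Proof. by move=> tv; rewrite /pullback2 asboolT. Qed.

Lemma pullback2N n v :
  pullback2 F (fun x w => - B x w) n v = - pullback2 F B n v.
Proof.
rewrite /pullback2; case: asboolP => _; last by rewrite oppr0.
by rewrite comapN.
Qed.

(** Shifting a covector on M by [B (F n) (dmap F n U)] shifts its pullback by [pullback2 F B n U].
    Asking only for equality of fibres lets the lemma serve the maps of objects as well as the
    morphisms between them. *)
Lemma forward_dirac_gauge (DN DN' : diracStructure N) (DM DM' : diracStructure M) :
  two_form B ->
  (forall n, DN' n = gauge_fib DN (pullback2 F B) n) ->
  (forall m, DM' m = gauge_fib DM B m) ->
  forward_dirac DN DM F -> forward_dirac DN' DM' F.
Proof.
move=> [Bc _ _ _] eN eM [sF dF]; split=> // n; apply/seteqP; split=> s.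
- rewrite eM => -[t]; rewrite dF => -[U [b [-> tU cb DU]]] <-.
  exists U, (b + B (F n) (dmap F n U)); split=> //; first exact: cotangentD.
  by rewrite eN gauge_fibP/= pullback2_comap// comapD addrK.
- move=> [U [b [-> tU cb]]]; rewrite eN eM !gauge_fibP dF /= => DU.
  exists U, (b - B (F n) (dmap F n U)); split=> //.
    by apply: cotangentD => //; exact: cotangentN.
  by rewrite comapD comapN -pullback2_comap.
Qed.

End pullbackGauge.

Lemma pullback2_comp (R : realType) (N M P : preManifold R) (G : M -> P)
  (F : N -> M) (B : P -> tvec P -> covec P) n v :
  smooth_map G -> smooth_map F ->
  pullback2 (G \o F) B n v = pullback2 F (pullback2 G B) n v.
Proof.
move=> sG sF; rewrite /pullback2; case: asboolP => // tv.
rewrite asboolT; last exact: tangent_dmap.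
by rewrite comap_comp// dmap_comp.
Qed.

(** Supplies comparison morphisms over the identity map when two gauge transformations restore the
    original fibres. *)
Lemma forward_dirac_eq (R : realType) (M : preManifold R)
  (D D' : diracStructure M) : (forall x, D x = D' x) -> forward_dirac D D' id.
Proof.
move=> DD'; have [sid H] := forward_dirac_id D.
by split=> // x; rewrite -DD'; exact: H.
Qed.

(** * The gauge functor between Hamiltonian categories *)

Section gaugeFunctor.
Variables (R : realType) (M : manifold R) (D D' : diracStructure M).
Variables (B : M -> tvec M -> covec M) (clB : closed_two_form B).
Hypothesis DD' : forall x, D' x = gauge_fib D B x.

Definition untwist (s : M -> gtvec M) (x : M) : gtvec M :=
  ((s x).1, (s x).2 - B x (s x).1).

Lemma section_untwist s : section_of D' s -> section_of D (untwist s).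
Proof.
move=> [[s1 s2] Ds]; split; last first.
  by move=> x; have := Ds x; rewrite DD' gauge_fibP.
split=> //=; apply: one_form_onD => //; apply: one_form_onN.
have [Bc _ _ sB] := clB.1.
split=> // V Y oV HY x _ Vx; apply: (sB V) => //.
by apply: vfieldW s1.
Qed.

(** Sections thus keep their support, and compact supports correspond. *)
Lemma untwist_eq0 s x : untwist s x = 0 <-> s x = 0.
Proof.
have B0 := two_form0 x clB.1.
rewrite /untwist; case: (s x) => v b /=; split=> -[-> ].
  by rewrite B0 subr0 => ->.
by move=> ->; rewrite B0 subr0.
Qed.

Section object.
Variable X : hamObject D.
Let F := @ham_map _ _ _ X.
Let sF : smooth_map F := (ham_strong X).1.1.

Definition gauge_ham_dirac : diracStructure (ham_space X) :=
  gaugeDirac (ham_dirac X) (closed_pullback2 sF clB).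

Lemma gauge_strong : strong_dirac gauge_ham_dirac D' F.
Proof.
have [fF kF] := ham_strong X; split.
  by apply: (forward_dirac_gauge clB.1 _ DD' fF).
move=> n U dU0 /gauge_fibP/= DU; apply: (kF n) => //.
have [tU _] := dirac_sub DU.
(* On the kernel of the differential the pulled-back form contributes 0, so the two kernel
   conditions agree. *)
move: DU; rewrite pullback2_comap// -/F dU0 (two_form0 _ clB.1).
by rewrite comap0 subr0.
Qed.

(** The sets from which [xget] chooses coincide: once [dmap F n v] is [(s (F n)).1], the covector
    [pullback2 F B n v] is the pullback of the one subtracted by [untwist]. *)
Lemma zeta_untwist s :
  zeta gauge_ham_dirac F s = zeta (ham_dirac X) F (untwist s).
Proof.
apply/funext => n; rewrite /zeta; congr (xget 0 _); apply/seteqP.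
have E v : tangent n v -> dmap F n v = (s (F n)).1 ->
    (v, comap F n (s (F n)).2 - pullback2 F B n v) =
    (v, comap F n (untwist s (F n)).2) :> gtvec _.
  by move=> tv dv; rewrite pullback2_comap// dv -comapN -comapD.
split=> v [tv dv Dv]; split=> //.
  by rewrite -E//; move/gauge_fibP: Dv.
by apply/gauge_fibP; rewrite E.
Qed.

Lemma gauge_complete : complete_dirac gauge_ham_dirac D' F.
Proof.
move=> s Ds cs; rewrite zeta_untwist; apply: (@ham_complete _ _ _ X).
  exact: section_untwist.
suff -> : [set m | untwist s m <> 0] = [set m | s m <> 0] by [].
by apply/seteqP; split=> m /= H /untwist_eq0.
Qed.

Definition gauge_object : hamObject D' :=
  HamObject gauge_strong gauge_complete (@ham_surjective _ _ _ X)
    (@ham_submersion _ _ _ X).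

End object.

Lemma gauge_hom_subproof X Y (f : hamHom X Y) :
  forward_dirac (gauge_ham_dirac X) (gauge_ham_dirac Y) (sval f) /\
  ham_map X = ham_map Y \o sval f.
Proof.
case: f => f [df ef]; split=> //=.
have sY := (ham_strong Y).1.1.
(* The form gauging the target is the pullback of [B] by [ham_map Y]; by [ef] its pullback along [f]
   is the form gauging the source. *)
apply: (@forward_dirac_gauge _ _ _ _ (pullback2 (ham_map Y) B) _ _ _ _ _ _ _ df).
- exact: (closed_pullback2 sY clB).1.
- move=> n; rewrite /gauge_ham_dirac/= /gauge_fib; apply: eq_imagel => -[v b] _.
  by rewrite ef pullback2_comp//; exact: df.1.
- by [].
Qed.

Definition gauge_hom X Y (f : hamHom X Y) :
    hamHom (gauge_object X) (gauge_object Y) :=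
  exist _ (sval f) (gauge_hom_subproof f).

Lemma gauge_hom_id X : gauge_hom (hamId X) = hamId (gauge_object X).
Proof. exact: hamHom_inj. Qed.

Lemma gauge_hom_comp X Y Z (g : hamHom Y Z) (f : hamHom X Y) :
  gauge_hom (hamComp g f) = hamComp (gauge_hom g) (gauge_hom f).
Proof. exact: hamHom_inj. Qed.

Definition gauge_functor : cfunctor (hamCategory D) (hamCategory D') :=
  @CFunctor (hamCategory D) (hamCategory D') gauge_object gauge_hom
    gauge_hom_id gauge_hom_comp.

End gaugeFunctor.

(** The two gaugings restore the fibres of each object, so identity maps form the isomorphism. The
    symmetric shape of the hypotheses on [B] and [C] lets one lemma treat both composites. *)
Lemma gauge_functorK (R : realType) (M : manifold R) (D D' : diracStructure M)
  (B C : M -> tvec M -> covec M) (clB : closed_two_form B)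
  (clC : closed_two_form C) (DD' : forall x, D' x = gauge_fib D B x)
  (D'D : forall x, D x = gauge_fib D' C x) : (forall x v, C x v = - B x v) ->
  nat_isomorphic (functor_comp (gauge_functor clC D'D) (gauge_functor clB DD'))
    (functor_id (hamCategory D)).
Proof.
move=> CB; set GF := functor_comp _ _.
have fibE (X : hamObject D) n : ham_dirac (GF X) n = ham_dirac X n.
  have EC v : pullback2 (ham_map X) C n v = - pullback2 (ham_map X) B n v.
    by rewrite -pullback2N; congr pullback2; apply/funext => x; apply/funext.
  apply/seteqP; split=> -[v b].
    by move=> /gauge_fibP/gauge_fibP/=; rewrite EC opprK addrK.
  by move=> Dvb; apply/gauge_fibP/gauge_fibP; rewrite /= EC opprK addrK.
pose eta (X : hamObject D) : hamHom (GF X) X :=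
  exist _ id (conj (forward_dirac_eq (fibE X)) erefl).
pose eta' (X : hamObject D) : hamHom X (GF X) :=
  exist _ id (conj (forward_dirac_eq (fun n => esym (fibE X n))) erefl).
exists eta; split=> [X|X Y f]; last exact: hamHom_inj.
by exists (eta' X); exact: hamHom_inj.
Qed.

Theorem corollary4p7 (R : realType) (M : manifold R) (D : diracStructure M)
  (B : M -> tvec M -> covec M) (hB : closed_two_form B) :
  integrable_dirac D ->
  equivalent_categories (hamCategory D) (hamCategory (gaugeDirac D hB)).
Proof.
move=> _; pose C x v := - B x v.
have hC : closed_two_form C by exact: closed_two_formN.
have DD' x : gaugeDirac D hB x = gauge_fib D B x by [].
(* This lets the second functor land in [hamCategory D] itself rather than over a twice gauged
   structure. *)
have D'D x : D x = gauge_fib (gaugeDirac D hB) C x.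
  apply/seteqP; split=> -[v b].
    by move=> Dvb; apply/gauge_fibP/gauge_fibP; rewrite /= /C opprK addrK.
  by move=> /gauge_fibP/gauge_fibP/=; rewrite /C opprK addrK.
exists (gauge_functor hB DD'), (gauge_functor hC D'D).
split; apply: gauge_functorK => x v; first by [].
by rewrite /C opprK.
Qed.
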